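(* Let $E$ be a smooth countable Borel equivalence relation on a standard Borel space $X$. Then $E$ has each of the properties $\mathsf{b}$, $\mathsf{d}$, $\mathsf{s}$, $\mathsf{r}$, $\mathsf{p}$, $\mathsf{t}$, $\mathsf{a}$, $\mathsf{i}$, $\mathsf{u}$. (In particular, $E$ has property $\mathsf{s}$.)
   Context: A Borel equivalence relation on a standard Borel space is countable if all its classes are countable. It is smooth if there are a standard Borel space $Y$ and a Borel map $f\colon X\to Y$ with $x\mathrel{E}x'\iff f(x)=f(x')$. If $E$, $F$ are equivalence relations on standard Borel spaces $X$, $Y$, a Borel homomorphism from $E$ to $F$, written $f\colon E\to F$, is a Borel function $f\colon X\to Y$ such that $x\mathrel{E}x'$ implies $f(x)\mathrel{F}f(x')$. $[\omega]^\omega$ is the set of infinite subsets of $\omega$, viewed as a Borel subset of $2^\omega$. $E_0(\omega^\omega)$ and $E_0([\omega]^\omega)$ denote eventual equality $=^*$ on $\omega^\omega$ (agreement at all but finitely many $n$) and on $[\omega]^\omega$ (finite symmetric difference). For $\alpha,\beta\in\omega^\omega$, $\alpha\leq^*\beta$ means $\alpha(n)\leq\beta(n)$ for all but finitely many $n$. $A\subset^*B$ means $A\smallsetminus B$ is finite, and $A^c=\omega\smallsetminus A$. For a standard Borel space $Z$, $E_{\mathsf{set}}(Z)$ is the equivalence relation on $Z^\omega$ given by $\langle z_n\rangle\mathrel{E_{\mathsf{set}}(Z)}\langle z_n'\rangle$ iff $\{z_n:n\in\omega\}=\{z'_n:n\in\omega\}$. A family $\mathcal F\subset[\omega]^\omega$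 is centered if every finite subfamily has infinite intersection. It is almost disjoint if any two distinct members have finite intersection. It is independent if every intersection of finitely many members of $\mathcal F$ with the complements of finitely many other members of $\mathcal F$ is infinite. In the following definitions of properties of a countable Borel equivalence relation $E$ on $X$, $\phi$ and $\psi$ always denote Borel homomorphisms. - $\mathsf{b}$: for every $\phi\colon E\to E_{\mathsf{set}}(\omega^\omega)$ there is $\psi\colon E\to E_0(\omega^\omega)$ such that for all $x\in X$, $n\in\omega$, $\phi(x)(n)\leq^*\psi(x)$. - $\mathsf{d}$: for every $\phi\colon E\to E_{\mathsf{set}}(\omega^\omega)$ there is $\psi\colon E\to E_0(\omega^\omega)$ such that for all $x$, $n$, $\psi(x)\not\leq^*\phi(x)(n)$. - $\mathsf{s}$: for every $\phi\colon E\to E_{\mathsf{set}}([\omega]^\omega)$ there is $\psi\colon E\to E_0([\omega]^\omega)$ such that for all $x$, $n$, $\psi(x)\subset^*\phi(x)(n)$ or $\psi(x)\subset^*\phi(x)(n)^c$. - $\mathsf{r}$: for every $\phi\colon E\to E_{\mathsf{set}}([\omega]^\omega)$ there is $\psi\colon E\to E_0([\omega]^\omega)$ such that for all $x$, $n$, $|\psi(x)\cap\phi(x)(n)|=|\psi(x)^c\cap\phi(x)(n)|=\aleph_0$. - $\mathsf{p}$: for every $\phi\colon E\to E_{\mathsf{set}}([\omega]^\omega)$ such that $\{\phi(x)(n):n\in\omega\}$ is centered for each $x$, there is $\psi\colon E\to E_0([\omega]^\omega)$ such that for all $x$, $n$, $\psi(x)\subset^*\phi(x)(n)$. - $\mathsf{t}$: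 for every $\phi\colon E\to E_{\mathsf{set}}([\omega]^\omega)$ such that for each $x$ the family $\{\phi(x)(n):n\in\omega\}$ admits a well-ordering compatible with $\subset^*$, there is $\psi\colon E\to E_0([\omega]^\omega)$ such that for all $x$, $n$, $\psi(x)\subset^*\phi(x)(n)$. - $\mathsf{a}$: for every $\phi\colon E\to E_{\mathsf{set}}([\omega]^\omega)$ such that $\{\phi(x)(n):n\in\omega\}$ is an infinite almost disjoint family for all $x$, there is $\psi\colon E\to E_0([\omega]^\omega)$ such that for all $x$, $n$, $|\psi(x)\cap\phi(x)(n)|<\aleph_0$. - $\mathsf{i}$: for every $\phi\colon E\to E_{\mathsf{set}}([\omega]^\omega)$ such that $\{\phi(x)(n):n\in\omega\}$ is independent for all $x$, there is $\psi\colon E\to E_0([\omega]^\omega)$ such that for all $x$, $\{\psi(x)\}\cup\{\phi(x)(n):n\in\omega\}$ is independent and $\psi(x)\neq^*\phi(x)(n)$ for all $n$. - $\mathsf{u}$: for every $\phi\colon E\to E_{\mathsf{set}}([\omega]^\omega)$ such that $\{\phi(x)(n):n\in\omega\}$ is centered for all $x$, there is $\psi\colon E\to E_0([\omega]^\omega)$ such that for all $x$, $n$, $|\psi(x)\cap\phi(x)(n)|=|\psi(x)^c\cap\phi(x)(n)|=\aleph_0$. *)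

(* Defs.v *)
From mathcomp Require Import all_boot all_order all_algebra.
From mathcomp Require Import all_classical all_reals all_analysis.
From mathcomp Require Import wochoice.

Set Implicit Arguments.
Unset Strict Implicit.
Unset Printing Implicit Defensive.

Local Open Scope classical_set_scope.

(** * Standard Borel spaces

    A measurable space is a type [T] with a set system [M : set_system T].
    [measurableType] is not used because its carriers are pointed, which would
    exclude the empty standard Borel space; [completeType] is avoided below
    for the same reason. *)

Definition polish (R : realType) (P : metricType R) : Prop :=
  (exists2 D : set P, countable D & dense D) /\
  (forall F : set_system P, ProperFilter F -> cauchy F ->
     exists x : P, F --> x).

(** [(T, M)] is isomorphic, as a measurable space, to a Polish space with its
    Borel sigma-algebra. *)
Definition standard_borel (R : realType) (T : Type) (M : set_system T) : Prop :=
  exists (P : metricType R) (f : T -> P),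
    [/\ polish P, bijective f &
        M = preimage_set_system setT f <<s @open P >>].

Definition borel_fun (T U : Type) (M : set_system T) (N : set_system U)
    (f : T -> U) : Prop :=
  forall B : set U, N B -> M (f @^-1` B).

Definition borel_prod (T U : Type) (M : set_system T) (N : set_system U) :
    set_system (T * U) :=
  <<s preimage_set_system setT fst M `|` preimage_set_system setT snd N >>.

(** The Borel structure of [Z^omega] is the product sigma-algebra. *)
Definition borel_pow (Z : Type) (M : set_system Z) : set_system (nat -> Z) :=
  <<s \bigcup_n preimage_set_system setT (fun z : nat -> Z => z n) M >>.

(** The Baire space, as a countable power of the discrete space [nat]. *)
Definition borel_baire : set_system (nat -> nat) :=
  borel_pow [set: set nat].

(** [[omega]^omega], the infinite elements of [2^omega], with the Borel
    structure induced by [2^omega]. *)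
Definition infset : Type := {A : nat -> bool | infinite_set [set n | A n]}.

Definition infset_set (A : infset) : set nat := [set n | sval A n].
Coercion infset_set : infset >-> set.

Definition borel_infset : set_system infset :=
  preimage_set_system setT (@sval _ _) (borel_pow [set: set bool]).

(** * Borel equivalence relations *)

Definition countable_borel_equivalence (X : Type) (M : set_system X)
    (E : X -> X -> Prop) : Prop :=
  [/\ RelationClasses.Equivalence E,
      borel_prod M M [set xy | E xy.1 xy.2] &
      forall x, countable [set y | E x y]].

Definition smooth (R : realType) (X : Type) (M : set_system X)
    (E : X -> X -> Prop) : Prop :=
  exists (Y : Type) (N : set_system Y) (f : X -> Y),
    [/\ standard_borel R N, borel_fun M N f &
        forall x x', E x x' <-> f x = f x'].

Definition borel_hom (X Y : Type) (M : set_system X) (E : X -> X -> Prop)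
    (N : set_system Y) (F : Y -> Y -> Prop) (f : X -> Y) : Prop :=
  borel_fun M N f /\ (forall x x', E x x' -> F (f x) (f x')).

Definition E0_baire (a b : nat -> nat) : Prop :=
  finite_set [set n | a n <> b n].

Definition E0_infset (A B : infset) : Prop := finite_set (A `+` B).

Definition E_set (Z : Type) (z z' : nat -> Z) : Prop := range z = range z'.

Definition to_Eset_baire (X : Type) (M : set_system X) (E : X -> X -> Prop)
    (phi : X -> nat -> nat -> nat) : Prop :=
  borel_hom M E (borel_pow borel_baire) (@E_set (nat -> nat)) phi.

Definition to_E0_baire (X : Type) (M : set_system X) (E : X -> X -> Prop)
    (psi : X -> nat -> nat) : Prop :=
  borel_hom M E borel_baire E0_baire psi.

Definition to_Eset_infset (X : Type) (M : set_system X) (E : X -> X -> Prop)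
    (phi : X -> nat -> infset) : Prop :=
  borel_hom M E (borel_pow borel_infset) (@E_set infset) phi.

Definition to_E0_infset (X : Type) (M : set_system X) (E : X -> X -> Prop)
    (psi : X -> infset) : Prop :=
  borel_hom M E borel_infset E0_infset psi.

(** * Combinatorics on [omega^omega] and [[omega]^omega] *)

Definition le_star (a b : nat -> nat) : Prop :=
  finite_set [set n | ~~ (a n <= b n)%N].

Definition sub_star (A B : set nat) : Prop := finite_set (A `\` B).

Definition centered (F : set infset) : Prop :=
  forall G : set infset, G `<=` F -> finite_set G ->
    infinite_set (\bigcap_(A in G) (A : set nat)).

Definition almost_disjoint (F : set infset) : Prop :=
  forall A B : infset, F A -> F B -> A <> B -> finite_set (A `&` B).

Definition independent (F : set infset) : Prop :=
  forall G H : set infset, G `<=` F -> H `<=` F ->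
    finite_set G -> finite_set H -> G `&` H = set0 ->
    infinite_set (\bigcap_(A in G) (A : set nat) `&`
                  \bigcap_(B in H) ~` (B : set nat)).

(** [F] admits a well-ordering compatible with almost inclusion.  A tower is
    usually taken to be decreasing, but both directions are allowed. *)
Definition star_well_ordered (F : set infset) : Prop :=
  exists2 W : rel infset, wo_chain W [pred A | A \in F] &
    (forall A B : infset, F A -> F B -> W A B -> sub_star B A) \/
    (forall A B : infset, F A -> F B -> W A B -> sub_star A B).

(** * The properties of equivalence relations *)

Section properties.
Variables (X : Type) (M : set_system X) (E : X -> X -> Prop).

Definition property_b : Prop :=
  forall phi, to_Eset_baire M E phi ->
  exists2 psi, to_E0_baire M E psi &
    forall x n, le_star (phi x n) (psi x).

Definition property_d : Prop :=
  forall phi, to_Eset_baire M E phi ->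
  exists2 psi, to_E0_baire M E psi &
    forall x n, ~ le_star (psi x) (phi x n).

Definition property_s : Prop :=
  forall phi, to_Eset_infset M E phi ->
  exists2 psi, to_E0_infset M E psi &
    forall x n, sub_star (psi x) (phi x n) \/ sub_star (psi x) (~` phi x n).

Definition property_r : Prop :=
  forall phi, to_Eset_infset M E phi ->
  exists2 psi, to_E0_infset M E psi &
    forall x n, infinite_set (psi x `&` phi x n) /\
                infinite_set (~` psi x `&` phi x n).

Definition property_p : Prop :=
  forall phi, to_Eset_infset M E phi ->
  (forall x, centered (range (phi x))) ->
  exists2 psi, to_E0_infset M E psi &
    forall x n, sub_star (psi x) (phi x n).

Definition property_t : Prop :=
  forall phi, to_Eset_infset M E phi ->
  (forall x, star_well_ordered (range (phi x))) ->
  exists2 psi, to_E0_infset M E psi &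
    forall x n, sub_star (psi x) (phi x n).

Definition property_a : Prop :=
  forall phi, to_Eset_infset M E phi ->
  (forall x, infinite_set (range (phi x)) /\
             almost_disjoint (range (phi x))) ->
  exists2 psi, to_E0_infset M E psi &
    forall x n, finite_set (psi x `&` phi x n).

Definition property_i : Prop :=
  forall phi, to_Eset_infset M E phi ->
  (forall x, independent (range (phi x))) ->
  exists2 psi, to_E0_infset M E psi &
    forall x, independent ([set psi x] `|` range (phi x)) /\
              (forall n, ~ E0_infset (psi x) (phi x n)).

Definition property_u : Prop :=
  forall phi, to_Eset_infset M E phi ->
  (forall x, centered (range (phi x))) ->
  exists2 psi, to_E0_infset M E psi &
    forall x n, infinite_set (psi x `&` phi x n) /\
                infinite_set (~` psi x `&` phi x n).

End properties.

(* Main.v *)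
Require Import Defs.
From mathcomp Require Import all_boot all_order all_algebra.
From mathcomp Require Import all_classical all_reals all_analysis.
From mathcomp Require Import zify lra.

Set Implicit Arguments.
Unset Strict Implicit.
Unset Printing Implicit Defensive.

Import Order.TTheory GRing.Theory Num.Theory.
Local Open Scope classical_set_scope.

(** Let [f] witness that [E] is smooth.  If [phi] is a homomorphism to an
    [E_set], then the set enumerated by [phi x] depends only on [f x], but its
    enumeration does not.  The theorem follows once there is a Borel enumeration
    [e x] of the same set that is equal at equivalent points
    ([invariant_enumeration]): the classical diagonal constructions of an upper
    bound, a pseudo-intersection, a splitting set and so on can be carried out
    from a given enumeration without any arbitrary choice, by taking least
    witnesses, so they are Borel functions of [e x] and in particular take equal
    values at equivalent points.

    The invariant enumeration is an instance of Lusin-Novikov uniformization.  The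
    pairs consisting of [f x] and the enumeration [phi x] form an analytic set
    ([standard_borel_range_analytic]), and [lusin_novikov] produces countably many
    Borel functions [h k] such that every term of [phi x] is one of the
    [h k (f x)].  Discarding those [h k (f x)] that are not terms of [phi x], a
    condition that is Borel and invariant, leaves the desired enumeration.

    The proof of [lusin_novikov] constructs, by finite approximations
    ([node_fusion]), two enumerations of the same set of which the second has a
    term missing from the first; the construction can only break down if the
    possible values of that term are captured by countably many Borel functions.
    The functions themselves come from [lusin_separation]: an analytic set that is
    the graph of a partial function is contained in the graph of a total Borel
    one.

    All of this takes place in powers of [nat] over arbitrary countable index
    types, with analytic sets defined as reindexings of closed sets, so that products
    and sequences of points need no coding.

    Four properties reduce to others: [d] of the bound for
    [b], [t] of the argument for [p] because finitely many members of a tower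
    have infinite intersection, [u] of [r], and [i] of the splitting set used for
    [r], applied to all infinite Boolean combinations.  For [a] the
    pseudo-intersection is taken of the complements, and for [s] of a decreasing
    sequence that decides each set. *)

(** * Predicates measurable for a sigma-algebra *)

Section sigma_algebra_predicates.
Variables (X : Type) (M : set_system X).
Hypothesis sM : sigma_algebra setT M.

Lemma sa_not (P : X -> Prop) : M [set x | P x] -> M [set x | ~ P x].
Proof. by case: sM => _ C _ /C; rewrite setTD. Qed.

Lemma sa_ex (T : countType) (P : T -> X -> Prop) :
  (forall t, M [set x | P t x]) -> M [set x | exists t, P t x].
Proof.
case: sM => M0 _ MU MP.
pose A (n : nat) := [set x | oapp (P^~ x) False (unpickle n)].
have -> : [set x | exists t, P t x] = \bigcup_n A n.
  apply/seteqP; split => x /=.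
    by case=> t Pt; exists (pickle t) => //; rewrite /A /= pickleK.
  by case=> n _; rewrite /A /=; case: (unpickle n) => //= t Pt; exists t.
by apply: MU => n; rewrite /A; case: (unpickle n).
Qed.

Lemma sa_all (T : countType) (P : T -> X -> Prop) :
  (forall t, M [set x | P t x]) -> M [set x | forall t, P t x].
Proof.
move=> MP; have -> : [set x | forall t, P t x] = [set x | ~ exists t, ~ P t x].
  by apply/seteqP; split => x /= => [H [t]|/forallNP H t]; [exact|exact: contrapT].
by apply: sa_not; apply: sa_ex => t; exact: sa_not.
Qed.

Lemma sa_cst (p : Prop) : M [set x | p].
Proof.
case: sM => M0 C _; have [hp|hp] := pselect p.
  rewrite (_ : mkset _ = setT `\` set0); first exact: C.
  by rewrite setD0; apply/seteqP; split.
by rewrite (_ : mkset _ = set0) //; apply/seteqP; split.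
Qed.

Lemma sa_and (P Q : X -> Prop) : M [set x | P x] -> M [set x | Q x] ->
  M [set x | P x /\ Q x].
Proof.
move=> MP MQ; have -> : [set x | P x /\ Q x] =
    [set x | forall b : bool, if b then P x else Q x].
  by apply/seteqP; split => x /= => [[? ?] []//|H]; split;
    [exact: (H true)|exact: (H false)].
by apply: sa_all => -[].
Qed.

Lemma sa_or (P Q : X -> Prop) : M [set x | P x] -> M [set x | Q x] ->
  M [set x | P x \/ Q x].
Proof.
move=> MP MQ; have -> : [set x | P x \/ Q x] =
    [set x | exists b : bool, if b then P x else Q x].
  apply/seteqP; split => x /= => [[? |?]|[[] ?]]; by [exists true|exists false|left|right].
by apply: sa_ex => -[].
Qed.

Lemma sa_imp (P Q : X -> Prop) : M [set x | P x] -> M [set x | Q x] ->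
  M [set x | P x -> Q x].
Proof.
move=> MP MQ; have -> : [set x | P x -> Q x] = [set x | ~ P x \/ Q x].
  apply/seteqP; split => x /= => [PQ|[]//].
  by have [Px|nPx] := pselect (P x); [right; exact: PQ|left].
by apply: sa_or => //; exact: sa_not.
Qed.

(** Measurability of a function into a countable discrete space. *)
Definition disc_meas (T : Type) (u : X -> T) := forall t, M [set x | u x = t].

Lemma sa_subst (T : countType) (u : X -> T) (P : T -> X -> Prop) :
  disc_meas u -> (forall t, M [set x | P t x]) -> M [set x | P (u x) x].
Proof.
move=> mu MP; have -> : [set x | P (u x) x] = [set x | exists t, u x = t /\ P t x].
  by apply/seteqP; split => x /= => [H|[t [-> //]]]; exists (u x).
by apply: sa_ex => t; exact: sa_and.
Qed.

Lemma disc_meas_subst (T U : countType) (u : X -> T) (w : T -> X -> U) :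
  disc_meas u -> (forall t, disc_meas (w t)) -> disc_meas (fun x => w (u x) x).
Proof.
move=> mu mw v; apply: (sa_subst (P := fun t x => w t x = v) mu) => t; exact: mw.
Qed.

Lemma disc_meas_cst (T : Type) (t : T) : disc_meas (fun=> t).
Proof. by move=> v; exact: sa_cst. Qed.

Lemma sa_eq (T : countType) (u w : X -> T) :
  disc_meas u -> disc_meas w -> M [set x | u x = w x].
Proof.
by move=> mu mw; apply: (sa_subst (P := fun t x => u x = t) mw) => t; exact: mu.
Qed.

End sigma_algebra_predicates.

(** * Closed and analytic sets in powers of the natural numbers *)

(** The sigma-algebra of the power of the discrete space [nat], for an
    arbitrary index type, so that products of such spaces are again of the same
    form. *)
Definition cyl (I : Type) : set_system (I -> nat) :=
  <<s [set B | exists i v, B = [set c | c i = v]] >>.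

Lemma cyl_sa (I : Type) : sigma_algebra setT (@cyl I).
Proof. exact: smallest_sigma_algebra. Qed.

Lemma cyl_coord (I : Type) i : disc_meas (@cyl I) (fun c => c i).
Proof. by move=> v; apply: sub_sigma_algebra; exists i, v. Qed.

Lemma cyl_preimage (X : Type) (M : set_system X) (I : Type) (g : X -> I -> nat) :
  sigma_algebra setT M -> (forall i, disc_meas M (g^~ i)) ->
  forall B, cyl B -> M (g @^-1` B).
Proof.
move=> sM mg; have [M0 _ MU] := sM.
apply: (@smallest_sub _ (sigma_algebra setT) _ [set B | M (g @^-1` B)]).
  split => /=; first by rewrite preimage_set0.
    by move=> A MA; rewrite setTD; exact: (sa_not sM).
  by move=> F MF; rewrite preimage_bigcup; exact: MU.
by move=> _ [i [v ->]] /=; exact: mg.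
Qed.

(** Pointwise convergence in the power of a discrete space.  Closedness is taken
    sequentially because it is then visibly stable under reindexing. *)
Definition pconv (I : Type) (a : nat -> I -> nat) (l : I -> nat) :=
  forall i, exists N, forall n, (N <= n)%N -> a n i = l i.

Definition pclosed (I : Type) (C : set (I -> nat)) :=
  forall a l, (forall n, C (a n)) -> pconv a l -> C l.

Lemma pclosed_reindex (I J : Type) (r : I -> J) (C : set (I -> nat)) :
  pclosed C -> pclosed [set c : J -> nat | C (c \o r)].
Proof.
move=> clC a l Ca al; apply: (clC (fun n => a n \o r)) => // i.
exact: (al (r i)).
Qed.

Lemma pclosed_and (I : Type) (P Q : (I -> nat) -> Prop) :
  pclosed [set c | P c] -> pclosed [set c | Q c] -> pclosed [set c | P c /\ Q c].
Proof.
move=> clP clQ a l H al.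
by split; [apply: (clP a)|apply: (clQ a)] => // n; have [] := H n.
Qed.

Lemma pclosed_all (I T : Type) (P : T -> (I -> nat) -> Prop) :
  (forall t, pclosed [set c | P t c]) -> pclosed [set c | forall t, P t c].
Proof. by move=> clP a l H al t; apply: (clP t a) => // n; exact: H. Qed.

Lemma pclosed_imp (I : Type) (p : Prop) (Q : (I -> nat) -> Prop) :
  pclosed [set c | Q c] -> pclosed [set c | p -> Q c].
Proof. by move=> clQ a l H al hp; apply: (clQ a) => // n; exact: H. Qed.

Lemma pclosed_eq (I : Type) (i j : I) : pclosed [set c | c i = c j].
Proof.
move=> a l H al; have [N aN] := al i; have [N' aN'] := al j.
by have := H (N + N')%N; rewrite /= aN ?leq_addr // aN' ?leq_addl.
Qed.

Lemma pclosed_coord (I : Type) (i : I) v : pclosed [set c | c i = v].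
Proof. by move=> a l H al; have [N aN] := al i; have := H N; rewrite /= aN. Qed.

(** The classical analytic sets are projections of closed sets; allowing an
    arbitrary reindexing in place of a projection makes images, products and
    fibre products instances of one construction. *)
Record souslin (I : Type) := Souslin {
  sindex : countType;
  sproj : I -> sindex;
  sbody : set (sindex -> nat);
  sbody_closed : pclosed sbody }.

Arguments sproj {I} s _.
Arguments sbody {I} s _.
Arguments sbody_closed {I} s.

Definition souslin_set (I : Type) (S : souslin I) : set (I -> nat) :=
  [set c \o sproj S | c in sbody S].

Definition analytic (I : Type) (A : set (I -> nat)) := exists S, A = souslin_set S.

Lemma pclosed_analytic (I : countType) (C : set (I -> nat)) :
  pclosed C -> analytic C.
Proof.
by move=> clC; exists (Souslin id clC); apply/seteqP; split => [c Cc|_ [c Cc <-]//];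
  exists c.
Qed.

Lemma analytic_image (I J : Type) (r : I -> J) (A : set (J -> nat)) :
  analytic A -> analytic [set c \o r | c in A].
Proof.
case=> S ->; exists (Souslin (sproj S \o r) (sbody_closed S)).
apply/seteqP; split => [_ [_ [c Cc <-] <-]|_ [c Cc <-]]; first by exists c.
by exists (c \o sproj S) => //; exists c.
Qed.

(** Witnesses for all the sets at once, required to project to the same point. *)
Lemma analytic_bigcap (I : Type) (A : nat -> set (I -> nat)) :
  (forall k, analytic (A k)) -> analytic (\bigcap_k A k).
Proof.
move=> /choice[S AS].
pose J : countType := {k : nat & sindex (S k)}.
pose at_ k : sindex (S k) -> J := @Tagged _ k (fun k => sindex (S k)).
pose C := [set c : J -> nat | forall k, sbody (S k) (c \o @at_ k) /\
  forall i, c (at_ k (sproj (S k) i)) = c (at_ 0 (sproj (S 0) i))].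
have clC : pclosed C.
  apply: pclosed_all => k; apply: pclosed_and.
    by apply: pclosed_reindex; exact: sbody_closed.
  by apply: pclosed_all => i; exact: pclosed_eq.
exists (Souslin (fun i => at_ 0 (sproj (S 0) i)) clC).
apply/seteqP; split => [x Ax|_ [c Cc <-] k _].
  have H k : exists c, sbody (S k) c /\ c \o sproj (S k) = x.
    by have := Ax k Logic.I; rewrite AS => -[c Cc <-]; exists c.
  pose cc k := projT1 (cid (H k)).
  have ccP k : sbody (S k) (cc k) /\ cc k \o sproj (S k) = x := projT2 (cid (H k)).
  exists (fun j : J => cc (tag j) (tagged j)); last by case: (ccP 0).
  move=> k; have [Ck ck] := ccP k; split=> [//|i] /=.
  by case: (ccP 0) => _ c0; rewrite -[LHS]/((cc k \o sproj (S k)) i) ck -c0.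
rewrite AS; have [Ck ek] := Cc k; exists (c \o @at_ k) => //.
by apply/funext => i /=; rewrite ek.
Qed.

(** A witness consists of the point, the number of a set, and witnesses for all the
    sets, of which only that for the selected set is constrained. *)
Lemma analytic_bigcup (I : countType) (A : nat -> set (I -> nat)) :
  (forall k, analytic (A k)) -> analytic (\bigcup_k A k).
Proof.
move=> /choice[S AS].
pose J : countType := (I + (unit + {k : nat & sindex (S k)}))%type.
pose at_ k (j : sindex (S k)) : J := inr (inr (@Tagged _ k (fun k => sindex (S k)) j)).
pose C := [set c : J -> nat | let k := c (inr (inl tt)) in
  sbody (S k) (c \o @at_ k) /\ forall i, c (at_ k (sproj (S k) i)) = c (inl i)].
have clC : pclosed C.
  move=> a l Ca al; have [N aN] := al (inr (inl tt)).
  pose k := l (inr (inl tt)); pose D := [set c : J -> nat |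
    sbody (S k) (c \o @at_ k) /\ forall i, c (at_ k (sproj (S k) i)) = c (inl i)].
  have clD : pclosed D.
    apply: pclosed_and; first by apply: pclosed_reindex; exact: sbody_closed.
    by apply: pclosed_all => i; exact: pclosed_eq.
  apply: (clD (fun n => a (N + n)%N)) => [n|j].
    by have := Ca (N + n)%N; rewrite /C /= aN ?leq_addr.
  by have [N' aN'] := al j; exists N' => n N'n; rewrite aN' // (leq_trans N'n) ?leq_addl.
exists (Souslin (inl : I -> J) clC).
apply/seteqP; split => [x [k0 _ Ax]|_ [c [Cc ec] <-]]; last first.
  exists (c (inr (inl tt))) => //; rewrite AS.
  by exists (c \o @at_ (c (inr (inl tt)))) => //; apply/funext => i /=; rewrite ec.
move: Ax; rewrite AS => -[c0 C0 e0].
have H k : exists c, k = k0 -> sbody (S k) c /\ c \o sproj (S k) = x.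
  have [->|//] := pselect (k = k0); first by exists c0.
  by exists (fun=> 0).
pose cc k := projT1 (cid (H k)).
have ccP k : k = k0 -> sbody (S k) (cc k) /\ cc k \o sproj (S k) = x :=
  projT2 (cid (H k)).
exists (fun j : J => match j with inl i => x i | inr (inl _) => k0
  | inr (inr j) => cc (tag j) (tagged j) end) => //.
by have [//|? ck] := ccP k0; split => // i; rewrite -ck.
Qed.

(** Suslin's theorem, easy half: the sets that are analytic together with their
    complement form a sigma-algebra. *)
Lemma cyl_analytic (I : countType) (B : set (I -> nat)) : cyl B -> analytic B.
Proof.
move=> cB; suff [] : analytic B /\ analytic (~` B) by [].
move: B cB; apply: (@smallest_sub _ (sigma_algebra setT) _
  [set B | analytic B /\ analytic (~` B)]).
  split => /=.
  - by split; apply: pclosed_analytic; rewrite ?setC0 // => a l H _; exact: (H 0).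
  - by move=> A [? ?]; rewrite setTD setCK.
  - move=> F FA; split; first by apply: analytic_bigcup => k; case: (FA k).
    by rewrite setC_bigcup; apply: analytic_bigcap => k; case: (FA k).
move=> _ [i [v ->]]; split; apply: pclosed_analytic; first exact: pclosed_coord.
by move=> a l H al; have [N aN] := al i; have := H N; rewrite /= aN.
Qed.

(** * Separation of analytic sets *)

(** Basic clopen sets are coded by finite sequences, so that there are countably
    many of them; indices are read through [pickle]. *)
Definition node (J : countType) (s : seq nat) : set (J -> nat) :=
  [set c | forall j, (pickle j < size s)%N -> c j = nth 0 s (pickle j)].

Definition trunc_pt (J : countType) (c : J -> nat) (n : nat) : seq nat :=
  mkseq (fun k => oapp c 0 (unpickle k)) n.

Lemma node_trunc (J : countType) (c : J -> nat) n : node (trunc_pt c n) c.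
Proof. by move=> j; rewrite size_mkseq => jn; rewrite nth_mkseq // pickleK. Qed.

Lemma node_nil (J : countType) (c : J -> nat) : node [::] c.
Proof. by []. Qed.

Lemma node_closed (J : countType) s : pclosed (@node J s).
Proof.
by apply: pclosed_all => j; apply: pclosed_imp; exact: pclosed_coord.
Qed.

Lemma node_rcons (J : countType) s (c : J -> nat) :
  node s c -> exists v, node (rcons s v) c.
Proof.
move=> sc; exists (oapp c 0 (unpickle (size s))) => j.
rewrite size_rcons ltnS leq_eqVlt nth_rcons => /predU1P[<-|js].
  by rewrite ltnn eqxx pickleK.
by rewrite js sc.
Qed.

Lemma node_truncS (J : countType) s (c : J -> nat) n :
  node s c -> (size s <= n)%N -> exists t, [/\ prefix s t, size t = n & node t c].
Proof.
move=> sc sn; exists (s ++ drop (size s) (trunc_pt c n)).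
rewrite prefix_prefix size_cat size_drop size_mkseq subnKC //; split=> // j.
rewrite size_cat size_drop size_mkseq subnKC // nth_cat => jn.
case: ifP => [/sc //|/negbT]; rewrite -leqNgt => js.
by rewrite nth_drop subnKC //; apply: node_trunc; rewrite size_mkseq.
Qed.

Lemma branch_limit (J : countType) (C : set (J -> nat)) (u : nat -> seq nat) :
  pclosed C -> (forall n, prefix (u n) (u n.+1)) -> (forall n, (n <= size (u n))%N) ->
  (forall n, exists c, C c /\ node (u n) c) ->
  exists2 c, C c & forall n, node (u n) c.
Proof.
move=> clC up us /choice[a aP].
have um m n : (m <= n)%N -> prefix (u m) (u n).
  move/subnK <-; elim: (n - m)%N => [|k IH].
    exact: prefix_refl.
  exact: prefix_trans IH (up _).
pose l (j : J) := nth 0 (u (pickle j).+1) (pickle j).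
have ul n (j : J) : (pickle j < size (u n))%N -> nth 0 (u n) (pickle j) = l j.
  move=> jn; rewrite /l; have jj := us (pickle j).+1.
  have [/um/prefixP[w ->]|/ltnW/um/prefixP[w ew]] := leqP n (pickle j).+1.
    by rewrite nth_cat jn.
  by rewrite ew nth_cat jj.
exists l; last by move=> n j /ul.
apply: (clC a) => [n|j]; first by case: (aP n).
exists (pickle j).+1 => n jn; case: (aP n) => _ ->; last exact: leq_trans (us n).
by apply: ul; exact: leq_trans (us n).
Qed.

(** Refining the trivial pair for ever, with [step n] imposed at stage [n], gives
    two branches; [good] ensures that their nodes meet the closed sets. *)
Lemma node_fusion (J J' : countType) (C : set (J -> nat)) (C' : set (J' -> nat))
    (good : seq nat -> seq nat -> Prop) (step : nat -> seq nat -> seq nat -> Prop) :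
  pclosed C -> pclosed C' -> good [::] [::] ->
  (forall s s', good s s' ->
    exists c c', [/\ C c, node s c, C' c' & node s' c']) ->
  (forall n s s', good s s' -> exists t t', [/\ prefix s t, prefix s' t',
    (size s < size t)%N, (size s' < size t')%N & good t t' /\ step n t t']) ->
  exists c c', [/\ C c, C' c' & forall n, exists t t',
    [/\ good t t', step n t t', (n < size t)%N, (n < size t')%N &
        node t c /\ node t' c']].
Proof.
move=> clC clC' good0 goodC ext.
have /choice[f fP] : forall p : nat * (seq nat * seq nat), exists q : seq nat * seq nat,
    good p.2.1 p.2.2 -> [/\ prefix p.2.1 q.1, prefix p.2.2 q.2,
      (size p.2.1 < size q.1)%N, (size p.2.2 < size q.2)%N &
      good q.1 q.2 /\ step p.1 q.1 q.2].
  move=> [n [s s']] /=; have [/(ext n)[t [t' tP]]|ng] := pselect (good s s').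
    by exists (t, t').
  by exists (s, s').
pose u := fix u n := if n is k.+1 then f (k, u k) else ([::], [::]).
have ug n : good (u n).1 (u n).2.
  by elim: n => [//|n /(fP (n, u n))[_ _ _ _ []]].
have uP n := fP (n, u n) (ug n).
have us n : (n <= size (u n).1)%N /\ (n <= size (u n).2)%N.
  elim: n => [//|n [h1 h2]]; have [_ _ h3 h4 _] := uP n.
  by split; [exact: leq_ltn_trans h3|exact: leq_ltn_trans h4].
have [c Cc cu] : exists2 c, C c & forall n, node (u n).1 c.
  apply: branch_limit => // n; [by case: (uP n)|by case: (us n)|].
  by have [c [c' [? ? ? ?]]] := goodC _ _ (ug n); exists c.
have [c' Cc' cu'] : exists2 c, C' c & forall n, node (u n).2 c.
  apply: branch_limit => // n; [by case: (uP n)|by case: (us n)|].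
  by have [? [c' [? ? ? ?]]] := goodC _ _ (ug n); exists c'.
exists c, c'; split => // n; exists (u n.+1).1, (u n.+1).2.
have [_ _ _ _ [? ?]] := uP n; have [? ?] := us n.+1.
by split.
Qed.

Definition separated (I : Type) (A B : set (I -> nat)) :=
  exists2 D, cyl D & A `<=` D /\ B `<=` ~` D.

(** With [D t t'] separating the pieces, the union over [t] of the intersections
    over [t'] separates the unions. *)
Lemma separated_bigcup (I : Type) (T T' : countType) (A : T -> set (I -> nat))
    (B : T' -> set (I -> nat)) : (forall t t', separated (A t) (B t')) ->
  separated [set c | exists t, A t c] [set c | exists t', B t' c].
Proof.
move=> H; have /choice[D DP] : forall p : T * T', exists D,
    cyl D /\ (A p.1 `<=` D /\ B p.2 `<=` ~` D).
  by move=> [t t']; have [D ? ?] := H t t'; exists D.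
exists [set c | exists t, forall t', D (t, t') c].
  apply: (sa_ex (@cyl_sa I)) => t; apply: (sa_all (@cyl_sa I)) => t'.
  by have [] := DP (t, t').
split => [c [t At]|c [t' Bt'] [t Dt]].
  by exists t => t'; have [_ [AD _]] := DP (t, t'); exact: AD.
by have [_ [_ BD]] := DP (t, t'); exact: (BD c Bt' (Dt t')).
Qed.

Lemma separatedS (I : Type) (A A' B B' : set (I -> nat)) :
  A `<=` A' -> B `<=` B' -> separated A' B' -> separated A B.
Proof.
by move=> AA BB [D cD [AD BD]]; exists D => //; split;
  [exact: subset_trans AD|exact: subset_trans BD].
Qed.

(** If the projections of two closed sets were not separated, nodes could be
    refined for ever while staying inseparable; the limit points would then have
    the same projection, since a coordinate on which they differ separates two of
    the nodes. *)
Theorem lusin_separation (I : Type) (A B : set (I -> nat)) :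
  analytic A -> analytic B -> (forall c, A c -> B c -> False) -> separated A B.
Proof.
case=> S -> [S' ->] disj; apply: contrapT => nsep.
pose im (S : souslin I) s := [set c \o sproj S | c in sbody S `&` node s].
pose good s s' := ~ separated (im S s) (im S' s').
have [|s s' ng|n s s' ng|] := @node_fusion _ _ _ _ good (fun _ _ _ => True)
  (sbody_closed S) (sbody_closed S').
- apply: contra_not nsep; apply: separatedS => _ [c Cc <-].
    by exists c => //; split => //; exact: node_nil.
  by exists c => //; split => //; exact: node_nil.
- suff [[c [Cc sc]] [c' [Cc' sc']]] : (sbody S `&` node s) !=set0 /\
      (sbody S' `&` node s') !=set0 by exists c, c'.
  split; apply/set0P/eqP => h0; apply: ng.
    exists set0; first by have [] := @cyl_sa I.
    by rewrite /im h0 image_set0 setC0; split.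
  exists setT; last by rewrite /im h0 image_set0 setCT; split.
  exact: (sa_cst (@cyl_sa I) True).
- apply: contrapT => next; apply: ng.
  have : separated [set c | exists v, im S (rcons s v) c]
                   [set c | exists v, im S' (rcons s' v) c].
    apply: separated_bigcup => v v'; apply: contrapT => ngv; apply: next.
    by exists (rcons s v), (rcons s' v'); rewrite !prefix_rcons !size_rcons.
  apply: separatedS => _ [c [Cc /node_rcons[v vc]] <-]; exists v; by exists c.
move=> c [c' [Cc Cc' cP]].
have [i ei] : exists i, c (sproj S i) <> c' (sproj S' i).
  apply: contrapT => /forallNP ee; apply: (disj (c \o sproj S)); first by exists c.
  by exists c' => //; apply/funext => i /=; apply: esym; apply: contrapT => ne; exact: (ee i).
pose n := maxn (pickle (sproj S i)) (pickle (sproj S' i)).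
have [t [t' [+ _ nt nt' [tc tc']]]] := cP n; apply.
exists [set d | d i = c (sproj S i)]; first exact: cyl_coord.
split=> _ [d [_ dt] <-] /=.
  have ht : (pickle (sproj S i) < size t)%N by rewrite (leq_ltn_trans _ nt) // leq_maxl.
  by rewrite dt // tc.
have ht : (pickle (sproj S' i) < size t')%N by rewrite (leq_ltn_trans _ nt') // leq_maxr.
by rewrite dt // -tc' //; exact: nesym.
Qed.

(** * Uniformization of analytic families of countable sets *)

Lemma least_ex (p : nat -> Prop) :
  exists m, (forall n, p n -> p m /\ (m <= n)%N) /\ ((forall n, ~ p n) -> m = 0).
Proof.
have [ex|nex] := pselect (exists n, p n); last first.
  by exists 0; split => // n pn; case: nex; exists n.
have ex' : exists n, `[< p n >] by case: ex => n pn; exists n; apply/asboolP.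
have [m /asboolP pm mmin] := ex_minnP ex'.
exists m; split => [n pn|/(_ m)//]; split => //; apply: mmin; exact/asboolP.
Qed.

Definition least (p : nat -> Prop) : nat := projT1 (cid (least_ex p)).

Lemma leastP (p : nat -> Prop) n : p n -> p (least p) /\ (least p <= n)%N.
Proof. exact: (projT2 (cid (least_ex p))).1. Qed.

Lemma least_eqP (p : nat -> Prop) v : least p = v <->
  (p v /\ (forall n, p n -> (v <= n)%N)) \/ ((forall n, ~ p n) /\ v = 0).
Proof.
rewrite /least; case: (cid (least_ex p)) => /= m [pm pm0]; split => [<-|].
  have [[n pn]|/forallNP np] := pselect (exists n, p n); last by right; rewrite pm0.
  by left; split => [|k /pm[]//]; case: (pm n pn).
case=> [[pv vmin]|[np ->]]; last exact: pm0.
by have [pm' mv] := pm v pv; apply/eqP; rewrite eqn_leq mv vmin.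
Qed.

Lemma disc_meas_least (X : Type) (M : set_system X) (p : X -> nat -> Prop) :
  sigma_algebra setT M -> (forall n, M [set x | p x n]) ->
  disc_meas M (fun x => least (p x)).
Proof.
move=> sM mp v; under eq_set do rewrite (propext (least_eqP _ _)).
apply: (sa_or sM); apply: (sa_and sM).
- exact: mp.
- by apply: (sa_all sM) => n; apply: (sa_imp sM) => //; exact: (sa_cst sM).
- by apply: (sa_all sM) => n; exact: (sa_not sM).
- exact: (sa_cst sM).
Qed.

Definition cyl_map (I J : Type) (h : (I -> nat) -> J -> nat) :=
  forall j, disc_meas (@cyl I) (fun y => h y j).

Lemma analytic_setI (I : Type) (A B : set (I -> nat)) :
  analytic A -> analytic B -> analytic (A `&` B).
Proof.
move=> anA anB.
rewrite (_ : _ `&` _ = \bigcap_k (if k is 0 then A else B)).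
  by apply: analytic_bigcap => -[].
by apply/seteqP; split => [x [Ax Bx] [|k] _ //|x AB]; split;
  [exact: (AB 0)|exact: (AB 1)].
Qed.

(** The level sets of each coordinate of the partial function have disjoint
    analytic projections, and these can be separated. *)
Lemma analytic_graph_extension (I J : countType) (A : set (I + J -> nat)) :
  analytic A ->
  (forall a b, A a -> A b -> a \o inl = b \o inl -> a \o inr = b \o inr) ->
  exists2 h : (I -> nat) -> J -> nat, cyl_map h &
    forall a, A a -> a \o inr = h (a \o inl).
Proof.
move=> anA funA.
have : forall jv : J * nat, exists D, cyl D /\
    [set a \o inl | a in A `&` [set a | a (inr jv.1) = jv.2]] `<=` D /\
    [set a \o inl | a in A `&` [set a | a (inr jv.1) <> jv.2]] `<=` ~` D.
  move=> [j v] /=; have [||c|D cD DP] := @lusin_separation I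
      [set a \o inl | a in A `&` [set a | a (inr j) = v]]
      [set a \o inl | a in A `&` [set a | a (inr j) <> v]].
  - apply: analytic_image; apply: analytic_setI => //; apply: cyl_analytic.
    exact: cyl_coord.
  - apply: analytic_image; apply: analytic_setI => //; apply: cyl_analytic.
    by apply: (sa_not (@cyl_sa _)); exact: cyl_coord.
  - move=> [a [Aa <-] <-] [b [Ab nb] ba]; apply: nb.
    exact: (congr1 (@^~ j) (funA _ _ Ab Aa ba)).
  - by exists D.
case/choice => D DP; pose h y j := least (fun v => D (j, v) y).
exists h => [j|a Aa].
  apply: (disc_meas_least (@cyl_sa I)) => v.
  by have [] := DP (j, v).
apply/funext => j; apply/esym/least_eqP; left; split => [|v Dv].
  by have [_ [AD _]] := DP (j, a (inr j)); apply: AD; exists a.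
have [<-//|ne] := pselect (a (inr j) = v).
have [_ [_ nD]] := DP (j, v); case: (nD (a \o inl)) => //; by exists a.
Qed.

(** A point of [A] is a parameter together with an enumeration of a countable set
    that depends only on the parameter.

    If finitely many coordinates confine a pair of enumerations of the same set,
    call this condition bad when countably many Borel functions capture all
    possible values of the [m]-th term of the second enumeration.  Suppose that all
    refinements deciding that this term differs from the [n]-th term of the first
    enumeration are bad.  Delete the countably many functions that witness this:
    what remains uncaptured is equal to the [n]-th term of every first
    enumeration, so it is a function of the parameter, and it extends to a Borel
    function; the original condition was bad.  If the trivial condition is not
    bad, fusion therefore produces two enumerations of the same set such that the
    [m]-th term of the second does not occur in the first. *)
Theorem lusin_novikov (I J : countType) (A : set (I + nat * J -> nat)) (m : nat) :
  analytic A ->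
  (forall a b, A a -> A b -> a \o inl = b \o inl ->
    forall n, exists k, forall j, a (inr (n, j)) = b (inr (k, j))) ->
  exists2 h : nat -> (I -> nat) -> J -> nat, forall k, cyl_map (h k) &
    forall a, A a -> exists k, (fun j => a (inr (m, j))) = h k (a \o inl).
Proof.
case=> S -> same.
pose C := sbody S.
pose y (c : sindex S -> nat) : I -> nat := c \o (sproj S \o inl).
pose z n (c : sindex S -> nat) (j : J) := c (sproj S (inr (n, j))).
pose covers (h : nat -> (I -> nat) -> J -> nat) s s' := forall c c', C c ->
  node s c -> C c' -> node s' c' -> y c = y c' -> exists k, z m c' = h k (y c).
apply: contrapT => nconcl.
pose good s s' := forall h, (forall k, cyl_map (h k)) -> ~ covers h s s'.
have good0 : good [::] [::].
  move=> h mh cov; apply: nconcl; exists h => // _ [c Cc <-].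
  by apply: (cov c c).
have good_ne s s' : good s s' ->
    exists c c', [/\ C c, node s c, C c' & node s' c'] /\ y c = y c'.
  move=> g; apply: contrapT => ne; apply: (g (fun _ _ _ => 0)).
    by move=> k j; exact: (disc_meas_cst (@cyl_sa I)).
  by move=> c c' Cc sc Cc' sc' yc; case: ne; exists c, c'.
pose step n t t' := forall c c', node t c -> node t' c' -> z n c <> z m c'.
have [|n s s' g|] := @node_fusion _ _ _ _ good step (sbody_closed S)
  (sbody_closed S) good0.
- by move=> s s' /good_ne[c [c' [? _]]]; exists c, c'.
- apply: contrapT => next.
  have : forall p : seq nat * seq nat, exists h : nat -> (I -> nat) -> J -> nat,
      (forall k, cyl_map (h k)) /\ (~ good p.1 p.2 -> covers h p.1 p.2).
    move=> [t t'] /=; have [gt|/existsNP[h /not_implyP[mh /contrapT cov]]] :=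
      pselect (good t t'); last by exists h.
    by exists (fun _ _ _ => 0); split => // k j; exact: (disc_meas_cst (@cyl_sa I)).
  case/choice => H HP.
  pose h k := if unpickle k is Some (t, t', k') then H (t, t') k' else fun _ _ => 0.
  have mh k : cyl_map (h k).
    rewrite /h; case: (unpickle k) => [[[t t'] k']|].
      by have [mH _] := HP (t, t'); exact: mH.
    by move=> j; exact: (disc_meas_cst (@cyl_sa I)).
  (* An uncaptured pair that differs on the two terms would lie in a refinement
     deciding so, which is bad, and would be captured by the functions [h]. *)
  have uncov c c' : C c -> node s c -> C c' -> node s' c' -> y c = y c' ->
      (forall k, z m c' <> h k (y c)) -> z n c = z m c'.
    move=> Cc sc Cc' sc' yc nh; apply/funext => j; apply: contrapT => zj.
    pose N := (size s + size s' + pickle (sproj S (inr (n, j))) +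
               pickle (sproj S (inr (m, j)))).+1.
    have [t [st tN tc]] := @node_truncS _ s c N sc ltac:(rewrite /N; lia).
    have [t' [st' tN' tc']] := @node_truncS _ s' c' N sc' ltac:(rewrite /N; lia).
    have [gt|ngt] := pselect (good t t').
      apply: next; exists t, t'; split; rewrite // ?tN ?tN' /N; [lia|lia|].
      split=> // d d' td td' /(congr1 (@^~ j)); rewrite /z td ?tN /N; last lia.
      rewrite td' ?tN' /N; last lia.
      rewrite -tc ?tN /N; last lia.
      by rewrite -tc' ?tN' /N; last lia.
    have [_ /(_ ngt c c' Cc tc Cc' tc' yc)[k zk]] := HP (t, t').
    by apply: (nh (pickle ((t, t'), k))); rewrite /h pickleK.
  (* The uncaptured pairs: a closed condition [P1] and a Borel condition [P2]. *)
  pose P1 := [set d : sindex S + sindex S -> nat | (C (d \o inl) /\ node s (d \o inl)) /\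
    (C (d \o inr) /\ node s' (d \o inr)) /\
    forall i, d (inl (sproj S (inl i))) = d (inr (sproj S (inl i)))].
  pose P2 := [set d : sindex S + sindex S -> nat | forall k, exists j,
    ~ d (inr (sproj S (inr (m, j)))) = h k (y (d \o inl)) j].
  have anP : analytic (P1 `&` P2).
    apply: analytic_setI; last first.
      have sc := @cyl_sa (sindex S + sindex S)%type.
      apply: cyl_analytic; apply: (sa_all sc) => k; apply: (sa_ex sc) => j.
      apply: (sa_not sc); apply: (sa_eq sc); first exact: cyl_coord.
      have mg : forall i, disc_meas (@cyl (sindex S + sindex S)) (fun d => y (d \o inl) i).
        by move=> i; exact: cyl_coord.
      move=> v; exact: (cyl_preimage sc mg (mh k j v)).
    apply: pclosed_analytic; apply: pclosed_and; last apply: pclosed_and.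
    - by apply: pclosed_and; apply: pclosed_reindex;
        [exact: sbody_closed|exact: node_closed].
    - by apply: pclosed_and; apply: pclosed_reindex;
        [exact: sbody_closed|exact: node_closed].
    - by apply: pclosed_all => i; exact: pclosed_eq.
  have P12 d : (P1 `&` P2) d -> [/\ C (d \o inl), node s (d \o inl), C (d \o inr),
      node s' (d \o inr) & y (d \o inl) = y (d \o inr)] /\
      forall k, z m (d \o inr) <> h k (y (d \o inl)).
    move=> [[[? ?] [[? ?] yd]] nd]; split.
      by split => //; apply/funext => i; exact: yd.
    by move=> k zk; have [j] := nd k; apply; exact: (congr1 (@^~ j) zk).
  pose q (i : I + J) := match i with inl i => inl (sproj S (inl i))
    | inr j => inr (sproj S (inr (m, j))) end.
  have [||h0 mh0 h0P] :=
    @analytic_graph_extension I J [set d \o q | d in P1 `&` P2].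
  + exact: analytic_image.
  + move=> _ _ [d /P12[[Cd sd Cd' sd' yd] nd] <-]
      [e /P12[[Ce se Ce' se' ye] ne] <-] yde.
    have yy : y (d \o inl) = y (e \o inl) := yde.
    rewrite -[LHS]/(z m (d \o inr)) -[RHS]/(z m (e \o inr)) -(uncov (d \o inl)) //.
    by apply: uncov => //; rewrite yy.
  + apply: (g (fun k => if k is k'.+1 then h k' else h0)) => [[|k] //|].
    move=> c c' Cc sc Cc' sc' yc.
    have [[k zk]|/forallNP nk] := pselect (exists k, z m c' = h k (y c)).
      by exists k.+1.
    exists 0; pose d i := match i with inl i => c i | inr j => c' j end.
    suff Pd : (P1 `&` P2) d by apply: (h0P (d \o q)); exists d.
    split; last first.
      move=> k; apply: contrapT => /forallNP zk; apply: (nk k).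
      by apply/funext => j; apply: contrapT; exact: zk.
    by do !split => //; move=> i; exact: (congr1 (@^~ i) yc).
move=> c [c' [Cc Cc' cP]].
(* Good pairs of nodes contain pairs of points with the same parameter. *)
have yc : y c = y c'.
  apply/funext => i; pose q := sproj S (inl i).
  have [t [t' [/good_ne[d [d' [[_ td _ td'] yd]]] _ nt nt' [tc tc']]]] := cP (pickle q).
  have := congr1 (@^~ i) yd; rewrite /y /= -/q td // td' // => e.
  by rewrite tc // tc'.
have [k zk] := same _ _ (ex_intro2 _ _ c' Cc' erefl) (ex_intro2 _ _ c Cc erefl)
  (esym yc) m.
have [t [t' [_ + _ _ [tc tc']]]] := cP k; move/(_ c c' tc tc'); apply.
by apply/funext => j; exact: esym (zk j).
Qed.

(** * Standard Borel spaces *)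

Lemma exists_mul_inv_lt (R : realType) (k : nat) (e : R) : (0 < e)%R ->
  exists n, (k%:R * n.+1%:R^-1 < e)%R.
Proof.
move=> e0; have [n] : exists n, (0 + n.+1%:R^-1 < e / k.+1%:R)%R.
  by apply: ltr_add_invr; rewrite divr_gt0 // ltr0n.
rewrite add0r => ne; exists n; apply: (@le_lt_trans _ _ (k.+1%:R * n.+1%:R^-1)%R).
  by rewrite ler_wpM2r ?invr_ge0 ?ler0n // ler_nat.
by rewrite mulrC -ltr_pdivlMr // ltr0n.
Qed.

Section polish.
Variables (R : realType) (P : metricType R).
Hypothesis polP : polish P.
Local Notation r n := (n.+1%:R^-1 : R)%R.

Lemma mdist_open_ball (p : P) (e : R) : open [set q | (mdist p q < e)%R].
Proof.
rewrite openE => q /= pq; apply/nbhs_ballP; exists (e - mdist p q)%R => /=.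
  by rewrite subr_gt0.
move=> z; rewrite ballEmdist /= => qz.
by apply: le_lt_trans (metric_triangle _ q _) _; rewrite -ltrBrDl.
Qed.

Lemma polish_dense_seq (p0 : P) :
  exists d : nat -> P, forall p e, (0 < e)%R -> exists i, (mdist (d i) p < e)%R.
Proof.
have [[D cD dD] _] := polP; have /pfcard_geP[D0|[d]] := cD.
  have [q [_]] : setT `&` D !=set0 by apply: dD; [exists p0|exact: openT].
  by rewrite D0.
exists d => p e e0; have [q [/= pq Dq]] : [set q | (mdist p q < e)%R] `&` D !=set0.
  by apply: dD (mdist_open_ball _ _); exists p; rewrite /= mdistxx.
by have [i _ di] := @surj _ _ _ _ d q Dq; exists i; rewrite di metric_sym.
Qed.

(** The inequality is not strict, so that the set of codes is closed. *)
Definition codes (d : nat -> P) (a : nat -> nat) (p : P) :=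
  forall n, (mdist (d (a n)) p <= r n)%R.

(** This is where completeness enters: if [l] is a limit of codes, points coded by
    good approximations of [l] form a Cauchy sequence, whose limit has code [l]. *)
Lemma codes_closed d : pclosed [set a | exists p, codes d a p].
Proof.
move=> a l /choice[p cp] al.
have [N NP] : exists N : nat -> nat, forall i n, (N i <= n)%N -> a n i = l i.
  by have [N ?] := choice al; exists N.
pose u n := p (\max_(i < n.+1) N i)%N.
have un i n : (i <= n)%N -> (mdist (d (l i)) (u n) <= r i)%R.
  move=> lein; have := cp (\max_(i < n.+1) N i)%N i; rewrite NP //.
  exact: (@leq_bigmax _ (fun i : 'I_n.+1 => N i) (Ordinal (lein : (i < n.+1)%N))).
have cu : cauchy (u @ \oo).
  apply/cauchyP => e e0; have [i] := exists_mul_inv_lt 1 e0; rewrite mul1r => ie.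
  exists (d (l i)); exists i => // n /= /un ni.
  by rewrite ballEmdist /=; exact: le_lt_trans ie.
have [q uq] := polP.2 _ _ cu; exists q => i; rewrite leNgt; apply/negP => iq.
have e0 : (0 < mdist (d (l i)) q - r i)%R by rewrite subr_gt0.
have [N0 _ N0P] := uq _ (nbhsx_ballx q _ e0).
have := N0P (N0 + i)%N (leq_addr _ _); rewrite /= ballEmdist /= metric_sym => lt.
have := metric_triangle (d (l i)) (u (N0 + i)%N) q; rewrite leNgt => /negP; apply.
have h := un i _ (leq_addl N0 i).
by rewrite -(subrKC (r i) (mdist (d (l i)) q)) ler_ltD.
Qed.

Lemma codes_total d : (forall p e, (0 < e)%R -> exists i, (mdist (d i) p < e)%R) ->
  forall p, exists a, codes d a p.
Proof.
move=> dd p; have /choice[a aP] : forall n, exists i, (mdist (d i) p < r n)%R.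
  by move=> n; apply: dd; rewrite invr_gt0 ltr0n.
by exists a => n; exact: ltW.
Qed.

(** The sets with the stated property form a sigma-algebra.  A coded point lies in
    an open [U] exactly when some ball [B(d (a n), 2/(n+1))] is contained in [U]:
    such a ball contains the point, and it is small when [n] is large. *)
Lemma codes_borel d B : <<s @open P >> B ->
  exists2 B', @cyl nat B' & forall a p, codes d a p -> (B p <-> B' a).
Proof.
have sc := @cyl_sa nat.
move: B; apply: (@smallest_sub _ (sigma_algebra setT) _ [set B |
  exists2 B', @cyl nat B' & forall a p, codes d a p -> (B p <-> B' a)]).
  split => /=.
  - by exists set0; [case: sc|].
  - move=> B [B' cB BB]; exists (~` B'); first exact: (sa_not sc).
    by move=> a p /BB BP; split => [[_ nB] /BP //|nB]; split => // /BP.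
  - move=> F FP; have /choice[F' F'P] : forall n, exists B', @cyl nat B' /\
        forall a p, codes d a p -> (F n p <-> B' a).
      by move=> n; have [B' ? ?] := FP n; exists B'.
    exists (\bigcup_n F' n).
      by case: sc => _ _; apply => n; case: (F'P n).
    move=> a p ap; split=> -[n _ ?]; exists n => //; exact/((F'P n).2 _ _ ap).
move=> U oU.
exists [set a | exists n, [set q | (mdist (d (a n)) q < 2 * r n)%R] `<=` U].
  apply: (sa_ex sc) => n.
  apply: (sa_subst (P := fun i _ => [set q | (mdist (d i) q < 2 * r n)%R] `<=` U) sc).
    exact: cyl_coord.
  by move=> i; exact: (sa_cst sc).
move=> a p ap; split => [Up|[n sub]].
  have /nbhs_ballP[e /= e0 eU] := open_nbhs_nbhs (conj oU Up).
  have [n ne] := exists_mul_inv_lt 3 e0; exists n => q /= dq; apply: eU.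
  move: (ap n) ne dq (metric_triangle p (d (a n)) q).
  rewrite ballEmdist /= (metric_sym p (d (a n))); set rn := (_^-1)%R.
  by move: (mdist p q) (mdist _ q) (mdist _ p) => x y z; lra.
apply: sub => /=; apply: le_lt_trans (ap n) _.
by rewrite ltr_pMl ?ltr1n // invr_gt0 ltr0n.
Qed.

End polish.

Section standard_borel_spaces.
Variables (R : realType) (X : Type) (M : set_system X).
Hypothesis bX : standard_borel R M.

Lemma standard_borel_sa : sigma_algebra setT M.
Proof.
have [P [f [_ _ ->]]] := bX.
by apply: sigma_algebra_preimage; exact: smallest_sigma_algebra.
Qed.

(** The coordinates are the indicators of the balls of radius [1/(n+1)] around the
    points of a dense sequence. *)
Lemma standard_borel_embedding (x0 : X) :
  exists w : X -> nat * nat -> nat, injective w /\ forall i, disc_meas M (w^~ i).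
Proof.
have [P [f [polP [g fK gK] MP]]] := bX.
have [d dd] := polish_dense_seq polP (f x0).
exists (fun x i => nat_of_bool (mdist (d i.1) (f x) < i.2.+1%:R^-1)%R).
split=> [x y xy|[i n] v /=]; last first.
  have mb : M [set x | (mdist (d i) (f x) < n.+1%:R^-1)%R].
    rewrite MP; exists [set p | (mdist (d i) p < n.+1%:R^-1)%R]; last by rewrite setTI.
    by apply: sub_sigma_algebra; exact: mdist_open_ball.
  have sM := standard_borel_sa; have := sa_subst (T := bool)
    (u := fun x => (mdist (d i) (f x) < n.+1%:R^-1)%R) (P := fun b _ => nat_of_bool b = v) sM.
  apply; last by move=> b; exact: (sa_cst sM).
  case; first by [].
  rewrite (_ : mkset _ = [set x | ~ (mdist (d i) (f x) < n.+1%:R^-1)%R]).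
    exact: (sa_not sM).
  by apply/seteqP; split=> z /=; [move->|move/negP/negbTE].
apply: (can_inj fK); apply: contrapT => /eqP; rewrite -mdist_gt0 => fxy.
have [n] := exists_mul_inv_lt 2 fxy.
have rn0 : (0 < n.+1%:R^-1 :> R)%R by rewrite invr_gt0 ltr0n.
have [i di] := dd (f x) _ rn0.
apply/negP; rewrite -leNgt.
have := congr1 (@^~ (i, n)) xy; rewrite /= di; case: ltP => // dy _.
have := metric_triangle (f x) (d i) (f y); rewrite (metric_sym (f x) (d i)).
move: di dy; set rn := (_^-1)%R.
by move: (mdist (f x) _) (mdist _ (f x)) (mdist _ (f y)) => a b c; lra.
Qed.

(** The image of a standard Borel space under a Borel map is analytic: the point
    is quantified through its codes, for which membership in a measurable set is
    a Borel condition. *)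
Lemma standard_borel_range_analytic (x0 : X) (K : countType) (F : X -> K -> nat) :
  (forall k, disc_meas M (F^~ k)) -> analytic (range F).
Proof.
move=> mF; have [P [f [polP [g fK gK] MP]]] := bX.
have [d dd] := polish_dense_seq polP (f x0).
have : forall kv : K * nat, exists B', @cyl nat B' /\
    forall a x, codes d a (f x) -> (F x kv.1 = kv.2 <-> B' a).
  move=> [k v] /=; have := mF k v; rewrite MP => -[B bB BF].
  have [B' cB' BB] := codes_borel d bB; exists B'; split => // a x /BB <-.
  have -> : B (f x) = (setT `&` f @^-1` B) x by rewrite setTI.
  by rewrite BF.
case/choice => B' BP.
have sc := @cyl_sa (K + nat)%type.
rewrite (_ : range F = [set c \o inl | c in [set c : K + nat -> nat |
    exists p, codes d (c \o inr) p] `&`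
    [set c : K + nat -> nat | forall k, B' (k, c (inl k)) (c \o inr)]]).
  apply: analytic_image; apply: analytic_setI.
    apply: pclosed_analytic.
    apply: (@pclosed_reindex _ (K + nat)%type inr [set a | exists p, codes d a p]).
    exact: codes_closed.
  apply: cyl_analytic; apply: (sa_all sc) => k.
  apply: (sa_subst (P := fun v c => B' (k, v) (c \o inr)) sc).
    exact: cyl_coord.
  have mr : forall n : nat, disc_meas (@cyl (K + nat)) (fun c => (c \o inr) n).
    by move=> n; exact: cyl_coord.
  by move=> v; exact: (cyl_preimage sc mr (BP (k, v)).1).
apply/seteqP; split => [_ [x _ <-]|_ [c [[p cp] cB] <-]].
  have [a ap] := codes_total dd (f x).
  exists (fun i => match i with inl k => F x k | inr n => a n end) => //; split.
    by exists (f x).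
  by move=> k; apply/((BP (k, F x k)).2 a x ap).
exists (g p) => //; apply/funext => k.
by apply/((BP (k, c (inl k))).2 (c \o inr) (g p)); rewrite ?gK.
Qed.

End standard_borel_spaces.

(** Embed the quotient in a power of [nat] by [w \o f].  The functions given by
    [lusin_novikov] yield candidates [cand x p] that depend only on the class of
    [x] and exhaust the terms of [phi x].  A candidate that is not a term of
    [phi x] is replaced by the first one that is. *)
Theorem invariant_enumeration (R : realType) (X : Type) (M : set_system X)
    (E : X -> X -> Prop) (J : countType) (phi : X -> nat -> J -> nat) :
  standard_borel R M -> smooth R M E ->
  (forall n j, disc_meas M (fun x => phi x n j)) ->
  (forall x x', E x x' -> range (phi x) = range (phi x')) ->
  exists e : X -> nat -> J -> nat, [/\ forall n j, disc_meas M (fun x => e x n j),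
    forall x x', E x x' -> e x = e x' & forall x, range (e x) = range (phi x)].
Proof.
move=> bX [Y [N [f [bY mf Ef]]]] mphi Ephi; have sM := standard_borel_sa bX.
have [[x0 _]|/forallNP nX] := pselect (exists x : X, True); last first.
  by exists phi; split => // x; case: (nX x).
have [w [winj mw]] := standard_borel_embedding bY (f x0).
pose F x (i : nat * nat + nat * J) : nat := match i with
  inl i => w (f x) i | inr j => phi x j.1 j.2 end.
have mF i : disc_meas M (F^~ i).
  by case: i => [i|[n j]] v; [exact: (mf _ (mw i v))|exact: mphi].
have anF := standard_borel_range_analytic bX x0 mF.
have /choice[h hP] : forall m, exists h : nat -> (nat * nat -> nat) -> J -> nat,
    (forall k, cyl_map (h k)) /\ forall x, exists k, phi x m = h k (w (f x)).
  move=> m; have [|h mh hP] := lusin_novikov m anF.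
    move=> _ _ [x _ <-] [y _ <-] xy n.
    have Exy : E x y by apply/Ef/winj.
    have : range (phi y) (phi x n) by rewrite -(Ephi _ _ Exy); exists n.
    by move=> [k _ yk]; exists k => j; rewrite /F /= yk.
  exists h; split => // x; have [k hk] := hP _ (ex_intro2 _ _ x Logic.I erefl).
  by exists k; exact: hk.
pose cand x (p : nat) : J -> nat :=
  if unpickle p is Some (m, k) then h m k (w (f x)) else fun=> 0.
pose occ x p := range (phi x) (cand x p).
pose e x n := cand x (if `[< occ x n >] then n else least (occ x)).
have mcand p j : disc_meas M (fun x => cand x p j).
  rewrite /cand; case: (unpickle p) => [[m k]|]; last exact: (disc_meas_cst sM).
  have mwf : forall i, disc_meas M (fun x => w (f x) i).
    by move=> i v; exact: (mf _ (mw i v)).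
  by move=> v; exact: (cyl_preimage sM mwf ((hP m).1 k j v)).
have mocc p : M [set x | occ x p].
  rewrite (_ : mkset _ = [set x | exists n, forall j, phi x n j = cand x p j]).
    apply: (sa_ex sM) => n; apply: (sa_all sM) => j; exact: (sa_eq sM).
  apply/seteqP; split=> x /= [n]; first by move=> _ nx; exists n => j; rewrite nx.
  by move=> nx; exists n => //; exact/funext.
have candE x x' : E x x' -> cand x = cand x' by move=> /Ef xx; rewrite /cand xx.
have occE x x' : E x x' -> occ x = occ x'.
  by move=> xx; rewrite /occ (candE _ _ xx) (Ephi _ _ xx).
have occ_phi x n : exists2 p, occ x p & cand x p = phi x n.
  have [k hk] := (hP n).2 x; exists (pickle (n, k)); last by rewrite /cand pickleK.
  by exists n; rewrite // /cand pickleK.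
exists e; split=> [n j v|x x' xx|x].
- apply: (sa_subst (P := fun p x => cand x p j = v) sM); last first.
    by move=> p; exact: mcand.
  move=> p; rewrite (_ : mkset _ = [set x | (occ x n /\ n = p) \/
      (~ occ x n /\ least (occ x) = p)]).
    apply: (sa_or sM); apply: (sa_and sM) => //; first exact: (sa_cst sM).
      exact: (sa_not sM).
    exact: (disc_meas_least sM).
  apply/seteqP; split=> x /=; first by case: asboolP; [left|right].
  by case: asboolP => [? [[]|[]]//|? [[]|[]]].
- by rewrite /e (candE _ _ xx) (occE _ _ xx).
- apply/seteqP; split=> [_ [n _ <-]|_ [n _ <-]].
    rewrite /e; case: asboolP => // _; have [p op _] := occ_phi x 0.
    by have [] := leastP op.
  have [p op pn] := occ_phi x n; exists p => //.
  by rewrite /e asboolT.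
Qed.

(** * Combinatorics of sequences of sets of natural numbers *)

Lemma finite_natP (A : set nat) :
  finite_set A <-> exists m, forall n, A n -> (n < m)%N.
Proof.
split=> [/finite_seqP[s ->]|[m Am]].
  exists (\max_(i <- s) i).+1 => n /= ns; rewrite ltnS.
  exact: (@leq_bigmax_seq _ s predT id).
by apply: (@sub_finite_set _ _ `I_m) => // n /Am.
Qed.

Lemma infinite_natP (A : set nat) :
  infinite_set A <-> forall m, exists n, (m <= n)%N /\ A n.
Proof.
split=> [infA m|H /finite_natP[m Am]].
  apply: contrapT => /forallNP nA; apply: infA; apply/finite_natP; exists m => n An.
  by rewrite ltnNge; apply/negP => mn; apply: (nA n).
by have [n [mn /Am]] := H m; rewrite ltnNge mn.
Qed.

Definition greedy (q : nat -> nat -> nat -> Prop) : nat -> nat :=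
  fix a n := if n is k.+1 then least (q k (a k)) else 0.

Lemma greedyP q : (forall n i, exists m, q n i m) ->
  forall n, q n (greedy q n) (greedy q n.+1).
Proof. by move=> qex n; have [m qm] := qex n (greedy q n); case: (leastP qm). Qed.

Lemma greedy_homo q : (forall n i, exists m, q n i m) ->
  (forall n i m, q n i m -> (i < m)%N) -> {homo greedy q : m n / (m < n)%N}.
Proof.
move=> qex qlt; apply: homo_ltn; first exact: ltn_trans.
by move=> n; apply: qlt; exact: greedyP.
Qed.

(** An infinite set almost contained in every [c n]: the terms of a greedy
    sequence running through the finite intersections. *)
Definition pseudo_inter (c : nat -> set nat) : set nat :=
  [set m | exists n, greedy (fun n i m => (i < m)%N /\
     forall k, (k <= n)%N -> c k m) n.+1 = m].

Lemma pseudo_interP (c : nat -> set nat) :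
  (forall n, infinite_set [set m | forall k, (k <= n)%N -> c k m]) ->
  infinite_set (pseudo_inter c) /\ forall n, sub_star (pseudo_inter c) (c n).
Proof.
move=> cinf; set q := fun n i m => (i < m)%N /\ forall k, (k <= n)%N -> c k m.
have qex n i : exists m, q n i m.
  by have [m [im cm]] := (infinite_natP _).1 (cinf n) i.+1; exists m.
have qhomo : {homo greedy q : m n / (m < n)%N} by apply: greedy_homo => // ? ? ? [].
have qge n : (n <= greedy q n)%N.
  by elim: n => // n IH; exact: leq_ltn_trans IH (qhomo _ _ (ltnSn n)).
split=> [|n].
  apply/infinite_natP => m; exists (greedy q m.+1); split; last by exists m.
  exact: leq_trans (leqnSn m) (qge _).
apply/finite_natP; exists (greedy q n.+1) => m [[k <-] nc].
rewrite ltnNge; apply/negP => nk; apply: nc.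
have [_] := greedyP qex k; apply; rewrite leqNgt; apply/negP => kn.
by have := qhomo k.+1 n.+1 kn; rewrite ltnNge nk.
Qed.

(** A set splitting every [c n] when these are infinite: consecutive intervals,
    the [n]-th of which meets [c k] for all [k <= n], are put alternately inside and
    outside. *)
Definition splitting (c : nat -> set nat) : set nat :=
  let g := greedy (fun n i m => (i < m)%N /\ forall k, (k <= n)%N ->
     exists j, [/\ (i <= j)%N, (j < m)%N & c k j]) in
  [set m | exists n, (g n.*2 <= m)%N /\ (m < g n.*2.+1)%N].

Lemma splittingP (c : nat -> set nat) : (forall n, infinite_set (c n)) ->
  forall n, infinite_set (splitting c `&` c n) /\
            infinite_set (~` splitting c `&` c n).
Proof.
move=> cinf; rewrite /splitting; set q := fun n i m => _ /\ _.
have qex n i : exists m, q n i m.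
  have /choice[j jP] : forall k, exists j, (i <= j)%N /\ c k j.
    by move=> k; exact: (infinite_natP _).1 (cinf k) i.
  exists (i + \max_(k < n.+1) j k).+1; split; first by rewrite ltnS leq_addr.
  move=> k kn; exists (j k); have [ij ck] := jP k; split=> //.
  rewrite ltnS (leq_trans _ (leq_addl _ _)) //.
  exact: (@leq_bigmax _ (fun k : 'I_n.+1 => j k) (Ordinal (kn : (k < n.+1)%N))).
have qhomo : {homo greedy q : m n / (m < n)%N} by apply: greedy_homo => // ? ? ? [].
have qhomo_le : {homo greedy q : m n / (m <= n)%N}.
  by move=> a b; rewrite leq_eqVlt => /predU1P[->//|/qhomo/ltnW].
have qge n : (n <= greedy q n)%N.
  by elim: n => // n IH; exact: leq_ltn_trans IH (qhomo _ _ (ltnSn n)).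
move=> k; split; apply/infinite_natP => m; pose n := (m + k)%N.
- have [_ /(_ k)[|j [j1 j2 cj]]] := greedyP qex n.*2; first by rewrite /n; lia.
  exists j; split; last by split => //; exists n.
  by rewrite (leq_trans _ j1) // (leq_trans _ (qge _)) // /n; lia.
- have [_ /(_ k)[|j [j1 j2 cj]]] := greedyP qex n.*2.+1; first by rewrite /n; lia.
  exists j; split; first by rewrite (leq_trans _ j1) // (leq_trans _ (qge _)) // /n; lia.
  split=> //= -[n' [g1 g2]]; have [n'n|nn'] := leqP n' n.
    have := qhomo_le n'.*2.+1 n.*2.+1 ltac:(lia).
    by rewrite leqNgt (leq_ltn_trans j1 g2).
  have := qhomo_le n.*2.+2 n'.*2 ltac:(lia).
  by rewrite leqNgt (leq_ltn_trans g1 j2).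
Qed.

(** Intersect successively with [c n] or with its complement, keeping an infinite
    set; [c n] is preferred, so that no choice is involved. *)
Fixpoint decide (c : nat -> set nat) (n : nat) : set nat :=
  if n is k.+1 then
    [set m | decide c k m /\ (c k m <-> infinite_set (decide c k `&` c k))]
  else setT.

Lemma decide_infinite c n : infinite_set (decide c n).
Proof.
elim: n => [|n IH] /=; first exact: infinite_nat.
have [inf|fin] := pselect (infinite_set (decide c n `&` c n)).
  apply: (sub_infinite_set _ inf) => m [dm cm]; split => //; split => //.
have fin' : finite_set (decide c n `&` c n) by apply: contrapT.
apply: (sub_infinite_set _ (infinite_setD IH fin')) => m [dm ncm]; split => //.
by split => // cm; case: ncm.
Qed.

Lemma decide_decr c m n : (m <= n)%N -> decide c n `<=` decide c m.
Proof.
move/subnK <-; elim: (n - m)%N => [//|k IH]; apply: subset_trans IH.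
by rewrite addSn => i [].
Qed.

(** Numbers code pairs of lists, which index the sets to be intersected and those
    whose complements are. *)
Definition combination (c : nat -> set nat) (n : nat) : set nat :=
  let p := odflt ([::], [::]) (unpickle n : option (seq nat * seq nat)) in
  [set m | (forall k, k \in p.1 -> c k m) /\ (forall k, k \in p.2 -> ~ c k m)].

(** Finite combinations are replaced by the whole of [nat], so that splitting
    applies. *)
Definition infinite_combination (c : nat -> set nat) (n : nat) : set nat :=
  [set m | infinite_set (combination c n) -> combination c n m].

Lemma infinite_combination_infinite c n : infinite_set (infinite_combination c n).
Proof.
have [inf|fin] := pselect (infinite_set (combination c n)).
  by apply: (sub_infinite_set _ inf) => m cm _.
by apply: (sub_infinite_set _ infinite_nat) => m _ /fin.
Qed.

(** * Borel constructions of infinite sets *)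

Section measurable_combinatorics.
Variables (X : Type) (M : set_system X).
Hypothesis sM : sigma_algebra setT M.

Lemma sa_infinite (A : X -> set nat) :
  (forall m, M [set x | A x m]) -> M [set x | infinite_set (A x)].
Proof.
move=> mA; under eq_set do rewrite (propext (infinite_natP _)).
apply: (sa_all sM) => m; apply: (sa_ex sM) => n; apply: (sa_and sM) => //.
exact: (sa_cst sM).
Qed.

Lemma disc_meas_greedy (q : X -> nat -> nat -> nat -> Prop) :
  (forall n i m, M [set x | q x n i m]) ->
  forall n, disc_meas M (fun x => greedy (q x) n).
Proof.
move=> mq; elim=> [|n IH] /=; first exact: (disc_meas_cst sM).
apply: (disc_meas_subst (w := fun a x => least (q x n a)) sM IH) => a.
exact: (disc_meas_least sM).
Qed.

Variable c : X -> nat -> set nat.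
Hypothesis mc : forall n m, M [set x | c x n m].

Lemma sa_pseudo_inter m : M [set x | pseudo_inter (c x) m].
Proof.
apply: (sa_ex sM) => n; apply: disc_meas_greedy => k i j.
apply: (sa_and sM); first exact: (sa_cst sM).
by apply: (sa_all sM) => l; apply: (sa_imp sM) => //; exact: (sa_cst sM).
Qed.

Lemma sa_splitting m : M [set x | splitting (c x) m].
Proof.
have mq n i j : M [set x | (i < j)%N /\ forall k, (k <= n)%N ->
    exists l, [/\ (i <= l)%N, (l < j)%N & c x k l]].
  apply: (sa_and sM); first exact: (sa_cst sM).
  apply: (sa_all sM) => k; apply: (sa_imp sM); first exact: (sa_cst sM).
  apply: (sa_ex sM) => l.
  rewrite (_ : mkset _ = [set x | ((i <= l)%N /\ (l < j)%N) /\ c x k l]).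
    by apply: (sa_and sM) => //; exact: (sa_cst sM).
  by apply/seteqP; split=> x /= [] // [].
apply: (sa_ex sM) => n; apply: (sa_and sM).
  apply: (sa_subst (P := fun a _ => (a <= m)%N) sM (disc_meas_greedy mq _)) => a.
  exact: (sa_cst sM).
apply: (sa_subst (P := fun a _ => (m < a)%N) sM (disc_meas_greedy mq _)) => a.
exact: (sa_cst sM).
Qed.

Lemma sa_decide n m : M [set x | decide (c x) n m].
Proof.
elim: n m => [|n IH] m /=; first exact: (sa_cst sM True).
have minf : M [set x | infinite_set (decide (c x) n `&` c x n)].
  by apply: sa_infinite => k; exact: (sa_and sM).
by apply: (sa_and sM) => //; apply: (sa_and sM); exact: (sa_imp sM).
Qed.

Lemma sa_combination n m : M [set x | combination (c x) n m].
Proof.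
apply: (sa_and sM); apply: (sa_all sM) => k; apply: (sa_imp sM) => //.
- exact: (sa_cst sM).
- exact: (sa_cst sM).
- exact: (sa_not sM).
Qed.

Lemma sa_infinite_combination n m : M [set x | infinite_combination (c x) n m].
Proof.
apply: (sa_imp sM); last exact: sa_combination.
by apply: sa_infinite => k; exact: sa_combination.
Qed.

End measurable_combinatorics.

Section borel_maps.
Variables (X : Type) (M : set_system X).
Hypothesis sM : sigma_algebra setT M.

Lemma borel_discP (T : countType) (u : X -> T) :
  borel_fun M [set: set T] u <-> disc_meas M u.
Proof.
split=> [mu t|mu B _]; first exact: (mu [set t]).
by apply: (sa_subst (P := fun t _ => B t) sM mu) => t; exact: (sa_cst sM).
Qed.

Lemma borel_powP (Z : Type) (N : set_system Z) (u : X -> nat -> Z) :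
  borel_fun M (borel_pow N) u <-> forall n, borel_fun M N (u^~ n).
Proof.
split=> [mu n B NB|mu].
  apply: (mu [set z | B (z n)]); apply: sub_sigma_algebra; exists n => //.
  by exists B => //; rewrite setTI.
have [M0 _ MU] := sM.
apply: (@smallest_sub _ (sigma_algebra setT) _ [set B | M (u @^-1` B)]).
  split => /=; first by rewrite preimage_set0.
    by move=> A MA; rewrite setTD; exact: (sa_not sM).
  by move=> F MF; rewrite preimage_bigcup; exact: MU.
by move=> _ [n _ [B NB <-]]; rewrite setTI; exact: mu.
Qed.

Lemma borel_baireP (u : X -> nat -> nat) :
  borel_fun M borel_baire u <-> forall n, disc_meas M (u^~ n).
Proof.
split=> [/borel_powP mu n|mu]; first exact/borel_discP.
by apply/borel_powP => n; exact/borel_discP.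
Qed.

Lemma borel_infsetP (u : X -> infset) :
  borel_fun M borel_infset u <-> forall n, M [set x | (u x : set nat) n].
Proof.
have -> : borel_fun M borel_infset u <->
    borel_fun M (borel_pow [set: set bool]) (fun x => sval (u x)).
  split=> mu B; last by move=> [C mC <-]; rewrite setTI; exact: mu.
  by move=> mB; apply: (mu (@sval _ _ @^-1` B)); exists B => //; rewrite setTI.
split=> [/borel_powP mu n|mu]; first exact: ((borel_discP _).1 (mu n) true).
apply/borel_powP => n; apply/borel_discP => -[]; first exact: mu.
rewrite (_ : mkset _ = [set x | ~ (u x : set nat) n]); first exact: (sa_not sM).
by apply/seteqP; split=> x /=; rewrite /infset_set /=; [move->|move/negP/negbTE].
Qed.

End borel_maps.

Lemma infset_ex (A : set nat) :
  exists B : infset, infinite_set A -> (B : set nat) = A.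
Proof.
have [infA|finA] := pselect (infinite_set A).
  have e : [set n | `[< A n >]] = A.
    by apply/seteqP; split=> n /= /asboolP.
  have infA' : infinite_set [set n | `[< A n >]] by rewrite e.
  by exists (exist _ (fun n => `[< A n >]) infA').
have infT : infinite_set [set n : nat | true].
  by apply: (sub_infinite_set _ infinite_nat).
by exists (exist _ (fun=> true) infT) => /finA.
Qed.

(** Total, so that it composes with set-valued constructions; finite sets are sent
    to an arbitrary value. *)
Definition to_infset (A : set nat) : infset := projT1 (cid (infset_ex A)).

Lemma to_infsetK (A : set nat) : infinite_set A -> (to_infset A : set nat) = A.
Proof. exact: (projT2 (cid (infset_ex A))). Qed.

Lemma infset_inj (A B : infset) : (A : set nat) = B -> A = B.
Proof.
move: A B => [A infA] [B infB]; rewrite /infset_set /= => AB.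
have {}AB : A = B.
  apply/funext => n; have [An nB] : A n <-> B n by rewrite -[A n : Prop]/([set n | A n] n) AB.
  by apply/idP/idP.
by subst B; congr exist; exact: Prop_irrelevance.
Qed.

Section invariant_infsets.
Variables (R : realType) (X : Type) (M : set_system X) (E : X -> X -> Prop).
Hypotheses (bX : standard_borel R M) (smE : smooth R M E).

Lemma invariant_enumeration_infset phi : to_Eset_infset M E phi ->
  exists e : X -> nat -> infset, [/\ forall n m, M [set x | (e x n : set nat) m],
    forall x x', E x x' -> e x = e x' & forall x, range (e x) = range (phi x)].
Proof.
have sM := standard_borel_sa bX.
move=> [/(borel_powP sM) mphi Ephi].
pose code (A : infset) (m : nat) := nat_of_bool (sval A m).
have code_inj : injective code.
  move=> A B AB; apply: infset_inj; apply/seteqP; split => m;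
  rewrite /infset_set /=; by have := congr1 (@^~ m) AB; rewrite /code; do 2 case: (sval _ m).
have mcode n m : disc_meas M (fun x => code (phi x n) m).
  move=> v; have mb := (borel_infsetP sM _).1 (mphi n) m.
  rewrite (_ : mkset _ = [set x | ((phi x n : set nat) m /\ 1 = v) \/
      (~ (phi x n : set nat) m /\ 0 = v)]).
    apply: (sa_or sM); apply: (sa_and sM) => //; try exact: (sa_cst sM).
    exact: (sa_not sM).
  apply/seteqP; split=> x /=; rewrite /code /infset_set /=.
    by case: (sval _ m); [left|right].
  by case: (sval _ m) => [[[]|[]]//|[[]|[]]//].
have Ecode x x' : E x x' -> range (fun n => code (phi x n)) = range (fun n => code (phi x' n)).
  have rc z : range (fun n => code (phi z n)) = code @` range (phi z).
    by rewrite image_comp.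
  by move=> /Ephi xx; rewrite !rc xx.
have [e [me Ee re]] := invariant_enumeration bX smE mcode Ecode.
have /choice[A AP] : forall p : X * nat, exists A, range (phi p.1) A /\ code A = e p.1 p.2.
  move=> [x n] /=; have : range (e x) (e x n) by exists n.
  by rewrite re => -[k _ <-]; exists (phi x k); split=> //; exists k.
exists (fun x n => A (x, n)); split=> [n m|x x' xx|x].
- rewrite (_ : mkset _ = [set x | e x n m = 1]); first exact: me.
  apply/seteqP; split=> x /=; rewrite /infset_set -(AP (x, n)).2 /code /=;
    by case: (sval _ m).
- apply/funext => n; apply: code_inj.
  by rewrite (AP (x, n)).2 (AP (x', n)).2 /= (Ee _ _ xx).
- apply/seteqP; split=> [_ [n _ <-]|_ [n _ <-]]; first by case: (AP (x, n)).
  have : range (e x) (code (phi x n)) by rewrite re; exists n.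
  case=> k _ ek; exists k => //; apply: code_inj.
  by rewrite (AP (x, k)).2.
Qed.

(** Equivalent points have the same enumeration, hence the same set computed from
    it. *)
Lemma to_E0_infset_intro (e : X -> nat -> infset) (Psi : (nat -> set nat) -> set nat) :
  (forall x x', E x x' -> e x = e x') ->
  (forall m, M [set x | Psi (fun n => e x n) m]) ->
  (forall x, infinite_set (Psi (fun n => e x n))) ->
  to_E0_infset M E (fun x => to_infset (Psi (fun n => e x n))).
Proof.
move=> Ee mPsi infPsi; split.
  apply/(borel_infsetP (standard_borel_sa bX)) => n.
  by under eq_set do rewrite to_infsetK //.
move=> x x' xx; rewrite /E0_infset (Ee _ _ xx) setYK; exact: finite_set0.
Qed.

End invariant_infsets.

(** * The cardinal-invariant properties *)

Lemma finite_inter_almost (A : set nat) (e : nat -> set nat) n :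
  infinite_set A -> (forall k, (k <= n)%N -> sub_star A (e k)) ->
  infinite_set [set m | forall k, (k <= n)%N -> e k m].
Proof.
move=> infA Ae; have finU : finite_set (\bigcup_(k in `I_n.+1) (A `\` e k)).
  by apply: bigcup_finite => [|k /= kn]; [exact: finite_II|exact: Ae].
apply: (sub_infinite_set _ (infinite_setD infA finU)) => m [Am nU] k kn.
by apply: contrapT => nek; apply: nU; exists k.
Qed.

Lemma centered_prefix (e : nat -> infset) n : centered (range e) ->
  infinite_set [set m | forall k, (k <= n)%N -> (e k : set nat) m].
Proof.
move=> /(_ (e @` `I_n.+1)) ce; apply: (sub_infinite_set _ (ce _ _)).
- by move=> m em k kn; apply: em; exists k.
- by move=> _ [k _ <-]; exists k.
- by apply: finite_image; exact: finite_II.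
Qed.

(** In a family linearly ordered by almost inclusion, finitely many members
    almost contain one among them. *)
Lemma star_well_ordered_prefix (e : nat -> infset) n : star_well_ordered (range e) ->
  infinite_set [set m | forall k, (k <= n)%N -> (e k : set nat) m].
Proof.
case=> W Wwo Wsub.
have total i j : W (e i) (e j) \/ W (e j) (e i).
  have [||B [[+ +] _]] := Wwo [pred C | C \in [set e i; e j]].
  - move=> C; rewrite !inE => -[] ->; by [exists i|exists j].
  - by exists (e i); rewrite !inE; left.
  - rewrite !inE => -[] -> lbB; [left|right]; apply: lbB; rewrite !inE;
      by [right|left].
have star i j : sub_star (e i) (e j) \/ sub_star (e j) (e i).
  by case: Wsub => sub; have [/sub|/sub] := total i j => H; [right|left|left|right];
    apply: H; [exists i|exists j|exists j|exists i|exists i|exists j|exists j|exists i].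
have starxx i : sub_star (e i) (e i) by rewrite /sub_star setDv; exact: finite_set0.
have [j _ jP] : exists2 j, (j <= n)%N & forall k, (k <= n)%N -> sub_star (e j) (e k).
  elim: n => [|n [j jn jP]]; first by exists 0 => // k; rewrite leqn0 => /eqP ->.
  have [jS|Sj] := star j n.+1.
    exists j; first exact: leqW.
    by move=> k; rewrite leq_eqVlt => /predU1P[->//|/jP].
  exists n.+1 => // k; rewrite leq_eqVlt => /predU1P[->//|/jP jk].
  apply: (@sub_finite_set _ _ ((e n.+1 `\` e j) `|` (e j `\` e k))).
    move=> m [em nek]; have [ejm|nej] := pselect ((e j : set nat) m); by [right|left].
  by rewrite finite_setU.
apply: (finite_inter_almost (A := e j)) jP.
exact: (svalP (e j)).
Qed.

Section smooth_properties.
Variables (R : realType) (X : Type) (M : set_system X) (E : X -> X -> Prop).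
Hypotheses (bX : standard_borel R M) (smE : smooth R M E).

(** The value at [m] is the maximum there of the first [m+1] enumerated functions;
    it bounds the [k]-th function from [k] on. *)
Lemma invariant_dominating phi : to_Eset_baire M E phi ->
  exists b : X -> nat -> nat, [/\ forall n, disc_meas M (b^~ n),
    forall x x', E x x' -> b x = b x' &
    forall x n, exists N, forall m, (N <= m)%N -> (phi x n m <= b x m)%N].
Proof.
have sM := standard_borel_sa bX.
move=> [/(borel_powP sM) mphi Ephi].
have mphi' n m : disc_meas M (fun x => phi x n m).
  exact: (borel_baireP sM _).1 (mphi n) m.
have [e [me Ee re]] := invariant_enumeration bX smE mphi' Ephi.
exists (fun x m => \max_(k < m.+1) e x k m)%N; split=> [m|x x' /Ee -> //|x n].
  suff mmax n : disc_meas M (fun x => \max_(k < n) e x k m)%N by exact: mmax.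
  elim: n => [|n IH] v; first by under eq_set do rewrite big_ord0; exact: (sa_cst sM).
  under eq_set do rewrite big_ord_recr /=.
  apply: (disc_meas_subst (w := fun a x => maxn a (e x n m)) sM IH) => a {}v.
  apply: (sa_subst (P := fun b _ => maxn a b = v) sM (me n m)) => b.
  exact: (sa_cst sM).
have : range (e x) (phi x n) by rewrite re; exists n.
move=> [k _ <-]; exists k => m km.
exact: (@leq_bigmax _ (fun k : 'I_m.+1 => e x k m) (Ordinal (km : (k < m.+1)%N))).
Qed.

Lemma smooth_property_b : property_b M E.
Proof.
move=> phi /invariant_dominating[b [mb Eb bdom]]; exists b.
  split=> [|x x' xx]; first exact/(borel_baireP (standard_borel_sa bX)).
  rewrite /E0_baire (Eb _ _ xx) (_ : mkset _ = set0); first exact: finite_set0.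
  by apply/seteqP; split.
move=> x n; have [N Nb] := bdom x n; apply/finite_natP; exists N => m /negP.
by rewrite ltnNge; apply: contra_notN => /Nb.
Qed.

Lemma smooth_property_d : property_d M E.
Proof.
move=> phi /invariant_dominating[b [mb Eb bdom]]; exists (fun x m => (b x m).+1).
  split=> [|x x' xx].
    apply/(borel_baireP (standard_borel_sa bX)) => m v.
    apply: (sa_subst (P := fun a _ => a.+1 = v) (standard_borel_sa bX) (mb m)) => a.
    exact: (sa_cst (standard_borel_sa bX)).
  rewrite /E0_baire (Eb _ _ xx) (_ : mkset _ = set0); first exact: finite_set0.
  by apply/seteqP; split.
move=> x n /finite_natP[N' N'b]; have [N Nb] := bdom x n.
have := N'b (N + N')%N; rewrite /= -leqNgt Nb ?leq_addr //.
by move=> /(_ isT); rewrite ltnNge leq_addl.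
Qed.

(** The pseudo-intersection is taken of a sequence [c] computed from the
    enumeration; the three uses are the sequence itself, its complements, and
    [decide]. *)
Lemma pseudo_inter_property phi (c : (nat -> set nat) -> nat -> set nat) :
  to_Eset_infset M E phi ->
  (forall e : X -> nat -> infset, (forall n m, M [set x | (e x n : set nat) m]) ->
    forall n m, M [set x | c (fun k => e x k) n m]) ->
  (forall x (e : nat -> infset), range e = range (phi x) -> forall n,
    infinite_set [set m | forall k, (k <= n)%N -> c (fun k => e k) k m]) ->
  exists2 psi, to_E0_infset M E psi & forall x, exists e : nat -> infset,
    range e = range (phi x) /\ forall n, sub_star (psi x) (c (fun k => e k) n).
Proof.
have sM := standard_borel_sa bX.
move=> hphi mc cinf.
have [e [me Ee re]] := invariant_enumeration_infset bX smE hphi.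
have P x := pseudo_interP (cinf x _ (re x)).
exists (fun x => to_infset (pseudo_inter (c (fun k => e x k)))).
  apply: (to_E0_infset_intro bX (Psi := pseudo_inter \o c) Ee) => [m|x].
    exact: (sa_pseudo_inter sM (mc e me)).
  by case: (P x).
move=> x; exists (e x); split => // n.
by have [infP sP] := P x; rewrite to_infsetK.
Qed.

Lemma range_index (e f : nat -> infset) n : range e = range f ->
  exists k, f n = e k.
Proof.
by move=> ef; have [k _ <-] : range e (f n) by [rewrite ef; exists n|]; exists k.
Qed.

Lemma pseudo_inter_of_prefixes phi : to_Eset_infset M E phi ->
  (forall x (e : nat -> infset), range e = range (phi x) -> forall n,
    infinite_set [set m | forall k, (k <= n)%N -> (e k : set nat) m]) ->
  exists2 psi, to_E0_infset M E psi & forall x n, sub_star (psi x) (phi x n).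
Proof.
move=> hphi phiinf.
have [psi hpsi psiP] := pseudo_inter_property (c := id) hphi (fun e me => me) phiinf.
exists psi => // x n; have [e [re sub]] := psiP x.
by have [k ->] := range_index n re.
Qed.

Lemma smooth_property_p : property_p M E.
Proof.
move=> phi hphi cphi; apply: pseudo_inter_of_prefixes => // x e re n.
by apply: centered_prefix; rewrite re.
Qed.

Lemma smooth_property_t : property_t M E.
Proof.
move=> phi hphi wphi; apply: pseudo_inter_of_prefixes => // x e re n.
by apply: star_well_ordered_prefix; rewrite re.
Qed.

(** Finitely many members of an infinite almost disjoint family do not cover: any
    other member is almost contained in the complement of each. *)
Lemma smooth_property_a : property_a M E.
Proof.
have sM := standard_borel_sa bX.
move=> phi hphi adphi.
have [||psi hpsi psiP] := pseudo_inter_property (c := fun e n => ~` e n) hphi.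
- by move=> e me n m; apply: (sa_not sM); exact: me.
- move=> x e re n; have [infphi ad] := adphi x; rewrite -re in infphi ad.
  have [k ek] : exists k, forall i, (i <= n)%N -> e i <> e k.
    apply: contrapT => /forallNP nk; apply: infphi.
    apply: (@sub_finite_set _ _ (e @` `I_n.+1)); last first.
      by apply: finite_image; exact: finite_II.
    move=> _ [k _ <-]; have /existsNP[i /not_implyP[lin /contrapT ei]] := nk k.
    by exists i.
  apply: (finite_inter_almost (A := e k)); first exact: (svalP (e k)).
  move=> i lin; rewrite /sub_star setDE setCK; apply: ad; [by exists k|by exists i|].
  exact: nesym (ek i lin).
exists psi => // x n; have [e [re sub]] := psiP x.
by have [k ->] := range_index n re; have := sub k; rewrite /sub_star setDE setCK.
Qed.

Lemma smooth_property_s : property_s M E.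
Proof.
have sM := standard_borel_sa bX.
move=> phi hphi.
have [||psi hpsi psiP] := pseudo_inter_property (c := decide) hphi.
- by move=> e me n m; exact: (sa_decide sM).
- move=> x e _ n; apply: (sub_infinite_set _ (@decide_infinite (fun k => e k) n)) => m dm k kn.
  exact: decide_decr kn _ dm.
exists psi => // x n; have [e [re sub]] := psiP x.
have [k ->] := range_index n re; have := sub k.+1 => /= subk.
have [inf|fin] := pselect (infinite_set (decide (fun k => e k) k `&` e k)).
  left; apply: sub_finite_set subk => m [pm nem]; split => // -[_ [_ /(_ inf)]].
  exact: nem.
right; apply: sub_finite_set subk => m [pm nem]; split => // -[_ [em _]].
by apply: fin; apply: em; exact: contrapT nem.
Qed.

Lemma splitting_property phi (c : (nat -> set nat) -> nat -> set nat) :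
  to_Eset_infset M E phi ->
  (forall e : X -> nat -> infset, (forall n m, M [set x | (e x n : set nat) m]) ->
    forall n m, M [set x | c (fun k => e x k) n m]) ->
  (forall (e : nat -> infset) n, infinite_set (c (fun k => e k) n)) ->
  exists2 psi, to_E0_infset M E psi & forall x, exists e : nat -> infset,
    range e = range (phi x) /\ forall n,
      infinite_set (psi x `&` c (fun k => e k) n) /\
      infinite_set (~` psi x `&` c (fun k => e k) n).
Proof.
have sM := standard_borel_sa bX.
move=> hphi mc cinf.
have [e [me Ee re]] := invariant_enumeration_infset bX smE hphi.
have P x := splittingP (cinf (e x)).
have infP x : infinite_set (splitting (c (fun k => e x k))).
  by apply: (sub_infinite_set _ (P x 0).1) => m [].
exists (fun x => to_infset (splitting (c (fun k => e x k)))).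
  apply: (to_E0_infset_intro bX (Psi := splitting \o c) Ee) => [m|//].
  exact: (sa_splitting sM (mc e me)).
by move=> x; exists (e x); split => // n; rewrite to_infsetK.
Qed.

Lemma smooth_property_r : property_r M E.
Proof.
move=> phi hphi.
have [|psi hpsi psiP] := splitting_property (c := id) hphi (fun e me => me).
  by move=> e n; exact: (svalP (e n)).
exists psi => // x n; have [e [re spl]] := psiP x.
by have [k ->] := range_index n re.
Qed.

Lemma smooth_property_u : property_u M E.
Proof. by move=> phi hphi _; exact: smooth_property_r. Qed.

Lemma finite_sub_range (e : nat -> infset) (G : set infset) :
  finite_set G -> G `<=` range e -> exists s : seq nat, G = e @` [set` s].
Proof.
move=> finG Ge; have /choice[i iP] : forall A, exists k, G A -> e k = A.
  by move=> A; have [/Ge[k _ ek]|nG] := pselect (G A); [exists k|exists 0].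
have /finite_seqP[s si] := finite_image i finG; exists s; rewrite -si.
apply/seteqP; split=> [A GA|_ [_ [A GA <-] <-]]; last by rewrite iP.
by exists (i A); [exists A|exact: iP].
Qed.

(** Both [S] and its complement meet every Boolean combination of the family in an
    infinite set, which is independence; for the combination [e n] alone it says
    that [e n] is not almost contained in [S]. *)
Lemma splitting_independent (e : nat -> infset) (S : infset) :
  independent (range e) ->
  (forall n, infinite_set (S `&` infinite_combination (fun k => e k) n) /\
             infinite_set (~` S `&` infinite_combination (fun k => e k) n)) ->
  independent ([set S] `|` range e) /\ forall n, ~ E0_infset S (e n).
Proof.
move=> inde spl.
(* Finite subfamilies are given by lists of indices, so that their combination is
   one of the split sets. *)
have comb G H : G `<=` range e -> H `<=` range e -> finite_set G -> finite_set H ->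
    G `&` H = set0 -> let C := \bigcap_(A in G) (A : set nat) `&`
                  \bigcap_(B in H) ~` (B : set nat) in
    infinite_set (S `&` C) /\ infinite_set (~` S `&` C).
  move=> Ge He finG finH GH /=; have infC := inde G H Ge He finG finH GH.
  have [s Gs] := finite_sub_range finG Ge; have [t Ht] := finite_sub_range finH He.
  pose n := pickle (s, t).
  suff <- : infinite_combination (fun k => e k) n = \bigcap_(A in G) (A : set nat) `&`
      \bigcap_(B in H) ~` (B : set nat) by [].
  have Cn : combination (fun k => e k) n = \bigcap_(A in G) (A : set nat) `&`
      \bigcap_(B in H) ~` (B : set nat).
    rewrite /combination /n pickleK /=; apply/seteqP; split=> m /= [Gm Hm]; split.
    - by move=> A; rewrite Gs => -[k ks <-]; exact: Gm.
    - by move=> A; rewrite Ht => -[k ks <-]; exact: Hm.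
    - by move=> k ks; apply: Gm; rewrite Gs; exists k.
    - by move=> k ks; apply: Hm; rewrite Ht; exists k.
  rewrite /infinite_combination Cn; apply/seteqP; split=> m /=; first exact.
  by [].
split=> [G H GF HF finG finH GH|n]; last first.
  have Ge : [set e n] `<=` range e by move=> _ ->; exists n.
  have := comb _ _ Ge (@sub0set _ _) (finite_set1 _) (finite_set0 _) (setI0 _).
  rewrite /= bigcap_set1 bigcap_set0 setIT => -[_]; apply: contra_not.
  by apply: sub_finite_set => m [nSm em]; right.
have sub (K : set infset) : K `<=` [set S] `|` range e -> K `\` [set S] `<=` range e.
  by move=> KF A [/KF[]].
have GH' : (G `\` [set S]) `&` (H `\` [set S]) = set0.
  by apply/seteqP; split=> // A [[GA _] [HA _]]; have : (G `&` H) A by []; rewrite GH.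
have [infS infnS] := comb _ _ (sub _ GF) (sub _ HF) (finite_setD _ finG)
  (finite_setD _ finH) GH'.
have [GS|nGS] := pselect (G S).
  apply: (sub_infinite_set _ infS) => m [Sm [Gm Hm]]; split => A HA.
    by have [->//|nA] := pselect (A = S); apply: Gm.
  apply: Hm; split => // AS; have : (G `&` H) S by split=> //; rewrite -AS.
  by rewrite GH.
apply: (sub_infinite_set _ infnS) => m [Sm [Gm Hm]]; split => A HA.
  by apply: Gm; split => // AS; apply: nGS; rewrite -AS.
by have [->//|nA] := pselect (A = S); apply: Hm.
Qed.

Lemma smooth_property_i : property_i M E.
Proof.
have sM := standard_borel_sa bX.
move=> phi hphi iphi.
have [||psi hpsi psiP] := splitting_property (c := infinite_combination) hphi.
- by move=> e me n m; exact: (sa_infinite_combination sM).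
- by move=> e n; exact: infinite_combination_infinite.
exists psi => // x; have [e [re spl]] := psiP x.
have [|ind ne] := splitting_independent _ spl; first by rewrite re.
by rewrite -re; split => // n; have [k ->] := range_index n re.
Qed.

End smooth_properties.

Theorem mainTheorem2 (R : realType) (X : Type) (M : set_system X)
    (E : X -> X -> Prop)
    (hX : standard_borel R M)
    (hE : countable_borel_equivalence M E)
    (hsmooth : smooth R M E) :
  property_b M E /\ property_d M E /\ property_s M E /\ property_r M E /\
  property_p M E /\ property_t M E /\ property_a M E /\ property_i M E /\
  property_u M E.
Proof.
split; first exact: (smooth_property_b hX hsmooth).
split; first exact: (smooth_property_d hX hsmooth).
split; first exact: (smooth_property_s hX hsmooth).
split; first exact: (smooth_property_r hX hsmooth).
split; first exact: (smooth_property_p hX hsmooth).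
split; first exact: (smooth_property_t hX hsmooth).
split; first exact: (smooth_property_a hX hsmooth).
split; first exact: (smooth_property_i hX hsmooth).
exact: (smooth_property_u hX hsmooth).
Qed.
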